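(* There exists a constant $C>0$ such that for all sufficiently large $x$, $$0\le \rho^{0}(x)-\rho^{\Omega}(x)\le C\,x^{\log 2/\log 5}\log x ,$$ where $\rho^{0}$ and $\rho^{\Omega}$ are the Dirichlet eigenvalue counting functions of the standard Laplacian on $\mathcal{SG}\setminus V_0$ and on the domain $\Omega\subset\mathcal{SG}$, respectively.
   Context: Let $q_0,q_1,q_2$ be the vertices of an equilateral triangle in the plane, $F_i x=\frac12(x+q_i)$, and let $\mathcal{SG}$ (Sierpinski gasket) be the unique nonempty compact set with $\mathcal{SG}=\bigcup_{i=0}^2F_i(\mathcal{SG})$. For a word $w=w_1\cdots w_n$ put $F_w=F_{w_1}\circ\cdots\circ F_{w_n}$. $V_0=\{q_0,q_1,q_2\}$, $V_m=\bigcup_{|w|=m}F_w(V_0)$; distinct $x,y\in V_m$ satisfy $x\sim_m y$ iff both lie in $F_w(V_0)$ for some word $w$ of length $m$. $L$ is the closed line segment joining $q_1$ and $q_2$, $\partial\Omega=\{q_0\}\cup L$, and $\Omega=\mathcal{SG}\setminus\partial\Omega$. Energy: $\mathcal{E}(u)=\lim_{m\to\infty}(5/3)^m\sum_{x\sim_m y}(u(x)-u(y))^2$ (each edge counted once); $\mathcal F$ is the space of continuous functions on $\mathcal{SG}$ with $\mathcal E(u)<\infty$; $\mathcal E(u,v)$ is the polarization. $\mu$ is the probability measure giving mass $3^{-m}$ to each $F_w(\mathcal{SG})$, $|w|=m$. A real $\lambda$ is a Dirichlet eigenvalue on $\mathcal{SG}\setminus V_0$ if there is a nonzero $u\in\mathcal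 F_0=\{v\in\mathcal F: v|_{V_0}=0\}$ with $\mathcal E(u,v)=\lambda\int uv\,d\mu$ for all $v\in\mathcal F_0$; it is a Dirichlet eigenvalue on $\Omega$ if the same holds with $\mathcal F_0$ replaced by $\mathcal F_\Omega=\{v\in\mathcal F: v|_{\partial\Omega}=0\}$. $\rho^{0}(x)$ (resp. $\rho^\Omega(x)$) is the number of Dirichlet eigenvalues on $\mathcal{SG}\setminus V_0$ (resp. on $\Omega$), counted with multiplicity, not exceeding $x$. *)

(* Defs.v *)
From HB Require Import structures.
From mathcomp Require Import all_boot all_order all_algebra.
From mathcomp Require Import all_classical all_reals all_analysis.

Set Implicit Arguments.
Unset Strict Implicit.
Unset Printing Implicit Defensive.

Import Order.TTheory GRing.Theory Num.Theory.
Import numFieldNormedType.Exports.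

Local Open Scope classical_set_scope.
Local Open Scope ring_scope.

Section SierpinskiGasket.
Context {R : realType}.
Local Notation plane := (R * R)%type.

Definition euclid_dist (x y : plane) : R :=
  Num.sqrt ((x.1 - y.1) ^+ 2 + (x.2 - y.2) ^+ 2).

Definition equilateral (q : 'I_3 -> plane) : Prop :=
  exists2 s : R, 0 < s & forall i j, i != j -> euclid_dist (q i) (q j) = s.

Variable q : 'I_3 -> plane.

Definition ifs (i : 'I_3) (x : plane) : plane := 2^-1 *: (x + q i).

(* [ifs_word [:: w1; ...; wn] = ifs w1 \o ... \o ifs wn] *)
Definition ifs_word (w : seq 'I_3) (x : plane) : plane := foldr ifs x w.

Definition is_gasket (SG : set plane) : Prop :=
  [/\ SG !=set0, compact SG & SG = \bigcup_(i in [set: 'I_3]) (ifs i @` SG)].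

Definition vertices0 : set plane := range q.

Definition adjacent (m : nat) (x y : plane) : Prop :=
  x <> y /\ exists w : seq 'I_3,
    [/\ size w = m, (ifs_word w @` vertices0) x & (ifs_word w @` vertices0) y].

(* The (finite) sum runs over ordered pairs, hence meets every edge twice. *)
Definition graph_energy (m : nat) (u : plane -> R) : R :=
  (5 / 3) ^+ m *
  (2^-1 * \sum_(p \in [set p : plane * plane | adjacent m p.1 p.2])
            (u p.1 - u p.2) ^+ 2).

Definition energy (u : plane -> R) : \bar R :=
  limn (fun m => (graph_energy m u)%:E).

(* A function on the gasket is represented by a function on the plane, only
   the values of which on [SG] matter. *)
Definition finite_energy (SG : set plane) : set (plane -> R) :=
  [set u | {within SG, continuous u} /\ (energy u < +oo)%E].

Definition energy_form (u v : plane -> R) : R :=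
  4^-1 * (fine (energy (u \+ v)) - fine (energy (u \- v))).

Definition dirichlet_domain (SG B : set plane) : set (plane -> R) :=
  [set u | finite_energy SG u /\ forall x, B x -> u x = 0].

Definition bottom_line : set plane :=
  [set (1 - t) *: q 1 + t *: q 2 | t in `[0, 1]].

Definition Omega_boundary : set plane := [set q 0] `|` bottom_line.

Definition is_gasket_measure (SG : set plane) (mu : probability plane R) :=
  forall w : seq 'I_3, mu (ifs_word w @` SG) = ((3 ^+ size w)^-1)%:E.

Section Spectrum.
Variables (SG : set plane) (mu : probability plane R) (B : set plane).

Definition eigenspace (lam : R) : set (plane -> R) :=
  [set u | dirichlet_domain SG B u /\
     forall v, dirichlet_domain SG B v ->
       energy_form u v = lam * \int[mu]_(x in SG) (u x * v x)].

Definition eigenvalue (lam : R) : Prop :=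
  exists2 u, eigenspace lam u & exists2 x, SG x & u x <> 0.

Definition free_on (n : nat) (e : 'I_n -> plane -> R) : Prop :=
  forall c : 'I_n -> R,
    (forall x, SG x -> \sum_(i < n) c i * e i x = 0) -> forall i, c i = 0.

(* Dimension of the eigenspace, as a space of functions on [SG]. *)
Definition multiplicity (lam : R) : \bar R :=
  ereal_sup [set n%:R%:E | n in [set n : nat | exists e : 'I_n -> plane -> R,
    (forall i, eigenspace lam (e i)) /\ free_on e]].

Definition counting_function (x : R) : \bar R :=
  \esum_(lam in [set lam | eigenvalue lam /\ lam <= x]) multiplicity lam.

End Spectrum.
End SierpinskiGasket.

(* Main.v *)
(* Idea.  By the min-max principle, the counting function at [x] is the largest
   dimension of a subspace of the form domain on which the energy is at most [x]
   times the squared L^2 norm.  Monotonicity in the domain gives the lower bound.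
   For the upper bound choose [k] with [16 x < 5^k]; then [2^k] is of order
   [x^(log 2 / log 5)].  On a [rho0 x]-dimensional such subspace for the vertex
   boundary, impose the [2^k] conditions [u (F_w q_0) = 0], [w] ranging over the
   words of length [k] in the letters 1 and 2, i.e. the cells of level [k] meeting
   the bottom line, and replace [u] by [0] on these cells.  On each of them
   [u^2 <= 16 E(u o F_w)], so that they carry mass at most
   [16 / 3^k * sum_w E(u o F_w)] but energy [(5/3)^k * sum_w E(u o F_w)], which
   exceeds [x] times the mass.  Hence cutting them off keeps the Rayleigh quotient
   below [x] and loses no dimension, and the difference is at most [2^k].

   The eigenfunctions needed for min-max are obtained by minimizing the Rayleigh
   quotient; compactness comes from pointwise limits along an ultrafilter, which are
   uniform because functions of bounded energy oscillate uniformly little on small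
   cells. *)

Require Import Defs.
From HB Require Import structures.
From mathcomp Require Import all_boot all_order all_algebra.
From mathcomp Require Import finmap.
From mathcomp Require Import all_classical all_reals all_analysis.
From mathcomp Require Import measurable_realfun.
From mathcomp Require Import ring lra.

Set Implicit Arguments.
Unset Strict Implicit.
Unset Printing Implicit Defensive.

Import Order.TTheory GRing.Theory Num.Theory.
Import numFieldNormedType.Exports.

Local Open Scope classical_set_scope.
Local Open Scope ring_scope.

(** * Counting eigenvalues of a form with compact minimizing sequences *)

Section FormsOnSubspace.
Context {R : realType} {V : lmodType R}.
Implicit Types (D : set V) (F : V -> V -> R).

Definition subspace_set D := D 0 /\ forall a u v, D u -> D v -> D (a *: u + v).

(** The axioms are relative to [D] because [energy_form] is defined for all functions, while its
    bilinearity is derived only for functions of bounded energy. *)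
Definition psd_form D F :=
  [/\ forall u v, D u -> D v -> F u v = F v u,
      forall a u v w, D u -> D v -> D w -> F (a *: u + v) w = a * F u w + F v w
    & forall u, D u -> 0 <= F u u].

Definition lincomb n (c : 'I_n -> R) (e : 'I_n -> V) := \sum_(i < n) c i *: e i.

Variables (D : set V) (F : V -> V -> R).
Hypotheses (sD : subspace_set D) (hF : psd_form D F).

Lemma subspaceZ a u : D u -> D (a *: u).
Proof. by case: sD => D0 DP Du; rewrite -[_ *: _]addr0; apply: DP. Qed.

Lemma subspaceD u v : D u -> D v -> D (u + v).
Proof. by case: sD => D0 DP Du Dv; rewrite -[u]scale1r; apply: DP. Qed.

Lemma subspaceB u v : D u -> D v -> D (u - v).
Proof. by move=> Du Dv; rewrite -scaleN1r; apply/subspaceD => //; apply: subspaceZ. Qed.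

Lemma subspace_sum (J : Type) (r : seq J) (P : pred J) (G : J -> V) :
  (forall i, P i -> D (G i)) -> D (\sum_(i <- r | P i) G i).
Proof.
by move=> h; apply: big_ind => //; [case: sD | move=> *; apply: subspaceD].
Qed.

Lemma subspace_lincomb n (c : 'I_n -> R) e : (forall i, D (e i)) -> D (lincomb c e).
Proof. by move=> De; apply: subspace_sum => i _; apply: subspaceZ. Qed.

Lemma formC u v : D u -> D v -> F u v = F v u.
Proof. by case: hF => h _ _; apply: h. Qed.

Lemma form_ge0 u : D u -> 0 <= F u u.
Proof. by case: hF => _ _; apply. Qed.

Lemma form0l w : D w -> F 0 w = 0.
Proof.
case: sD => D0 _; case: hF => _ FP _ Dw.
have := FP 1 0 0 w D0 D0 Dw; rewrite scaler0 addr0 mul1r => /eqP.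
by rewrite -subr_eq0 opprD addNKr oppr_eq0 => /eqP.
Qed.

Lemma formZl a u w : D u -> D w -> F (a *: u) w = a * F u w.
Proof.
move=> Du Dw; case: hF => _ FP _; case: (sD) => D0 _.
by rewrite -[_ *: _]addr0 FP // form0l // addr0.
Qed.

Lemma formDl u v w : D u -> D v -> D w -> F (u + v) w = F u w + F v w.
Proof. by move=> Du Dv Dw; case: hF => _ FP _; rewrite -[u in LHS]scale1r FP // mul1r. Qed.

Lemma form_suml (J : Type) (r : seq J) (c : J -> R) (e : J -> V) w :
  (forall i, D (e i)) -> D w ->
  F (\sum_(i <- r) c i *: e i) w = \sum_(i <- r) c i * F (e i) w.
Proof.
move=> De Dw; elim: r => [|i r IH]; first by rewrite !big_nil form0l.
rewrite !big_cons formDl ?formZl ?IH //; first exact: subspaceZ.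
by apply: subspace_sum => j _; apply: subspaceZ.
Qed.

Lemma form_sqrD u v : D u -> D v ->
  F (u + v) (u + v) = F u u + 2 * F u v + F v v.
Proof.
move=> Du Dv; have Duv := subspaceD Du Dv.
rewrite formDl // [F u _]formC // [F v _]formC // !formDl // (formC Dv Du); ring.
Qed.

Lemma form_sqrZ a u : D u -> F (a *: u) (a *: u) = a ^+ 2 * F u u.
Proof.
move=> Du; rewrite formZl //; last exact: subspaceZ.
by rewrite formC ?formZl // ?mulrA //; apply: subspaceZ.
Qed.

End FormsOnSubspace.

(** First-variation tool: with s = 1/(a+1), the value at t = -bs is b^2 s(as - 2), and as < 1 makes
    the last factor negative. *)
Lemma quadratic_ge0_eq0 {R : realType} (a b : R) :
  (forall t, 0 <= a * t ^+ 2 + 2 * b * t) -> b = 0.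
Proof.
move=> h; have a0 : 0 <= a by have := h 1; have := h (-1); lra.
pose s := (a + 1)^-1; have s0 : 0 < s by rewrite invr_gt0; lra.
have as1 : a * s < 1 by rewrite -ltr_pdivlMr // invrK; lra.
apply/eqP; rewrite -sqrf_eq0; apply/eqP.
have := h (- b * s); have := sqr_ge0 b => b0.
have -> : a * (- b * s) ^+ 2 + 2 * b * (- b * s) = b ^+ 2 * (s * (a * s - 2)) by ring.
move=> h1; have : s * (a * s - 2) < 0 by nra.
nra.
Qed.

(** * Min-max for a pair of forms *)

Section SpectralCounting.
Context {R : realType} {V : lmodType R}.
Variables (D : set V) (E I : V -> V -> R).
Hypotheses (sD : subspace_set D) (hE : psd_form D E) (hI : psd_form D I).

Definition eigenvector (lam : R) (u : V) :=
  D u /\ forall v, D v -> E u v = lam * I u v.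

(** Independence modulo the null space of [I]. For the gasket this is independence of the
    restrictions to [SG], since functions are defined on the whole plane. *)
Definition free_for n (e : 'I_n -> V) :=
  forall c : 'I_n -> R, I (lincomb c e) (lincomb c e) = 0 -> forall i, c i = 0.

Definition eigenmultiplicity (lam : R) : \bar R :=
  ereal_sup [set n%:R%:E | n in [set n : nat | exists e : 'I_n -> V,
    (forall i, eigenvector lam (e i)) /\ free_for e]].

Definition eigencount (x : R) : \bar R :=
  \esum_(lam in [set lam | (exists2 u, eigenvector lam u & I u u <> 0) /\ lam <= x])
    eigenmultiplicity lam.

(** The variational side of the min-max principle: by [eigencountP] the largest admissible [n] is
    the eigenvalue count. *)
Definition admissible (x : R) (n : nat) := exists e : 'I_n -> V,
  [/\ forall i, D (e i), free_for e & forall c : 'I_n -> R,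
      E (lincomb c e) (lincomb c e) <= x * I (lincomb c e) (lincomb c e)].

(** Abstract compactness of normalized minimizing sequences. The last clause keeps the limit in any
    orthogonal complement that contains the sequence. *)
Hypothesis compact_form : forall (u : nat -> V) (l : R),
  (forall n, D (u n)) -> (forall n, E (u n) (u n) <= l + n.+1%:R^-1) ->
  (forall n, I (u n) (u n) = 1) ->
  exists g, [/\ D g, E g g <= l, I g g = 1 &
    forall v, D v -> (forall n, I (u n) v = 0) -> I g v = 0].

Lemma eigenvector_orth l1 l2 u v : l1 != l2 ->
  eigenvector l1 u -> eigenvector l2 v -> I u v = 0.
Proof.
move=> l12 [Du eu] [Dv ev]; have := eu _ Dv; have := ev _ Du.
rewrite (formC hE) // (formC hI) // => -> /eqP.
by rewrite -subr_eq0 -mulrBl mulf_eq0 subr_eq0 eq_sym (negPf l12) => /eqP.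
Qed.

Lemma eigenvector_lincomb l n (c : 'I_n -> R) e :
  (forall i, eigenvector l (e i)) -> eigenvector l (lincomb c e).
Proof.
move=> he; have De i : D (e i) by case: (he i).
split; first exact: subspace_lincomb.
move=> v Dv; rewrite (form_suml sD hE) // (form_suml sD hI) // mulr_sumr.
by apply: eq_bigr => i _; case: (he i) => _ -> //; rewrite mulrCA.
Qed.

Lemma admissible_eigenvectors x l n (e : 'I_n -> V) : l <= x ->
  (forall i, eigenvector l (e i)) -> free_for e -> admissible x n.
Proof.
move=> lx he fe; have De i : D (e i) by case: (he i).
exists e; split=> // c; have [Dc ->//] := eigenvector_lincomb c he.
by apply: ler_wpM2r => //; exact: (form_ge0 hI).
Qed.

Section Bounded.
Variables (x : R) (N : nat).
(** Finiteness of the min-max dimension, so that suprema of dimensions are attained and a longest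
    eigensystem exists. *)
Hypothesis bounded : forall n, admissible x n -> (n <= N)%N.

Lemma sup_nat_max (A : set nat) : A 0%N -> (forall n, A n -> (n <= N)%N) ->
  exists2 n, A n & ereal_sup [set (k%:R%:E : \bar R) | k in A] = n%:R%:E.
Proof.
move=> A0 AN.
have exA : exists n, `[< A n >] by exists 0%N; apply/asboolP.
have bA : forall n, `[< A n >] -> (n <= N)%N by move=> n /asboolP/AN.
case: (ex_maxnP exA bA) => n /asboolP An nmax; exists n => //.
apply/eqP; rewrite eq_le; apply/andP; split.
  by apply: ge_ereal_sup => _ [k Ak <-]; rewrite lee_fin ler_nat nmax //; apply/asboolP.
by apply: ereal_sup_ubound; exists n.
Qed.

Lemma free_for0 (e : 'I_0 -> V) : free_for e.
Proof. by move=> c _ []. Qed.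

Lemma eigenmultiplicity_max l : l <= x -> exists2 n, eigenmultiplicity l = n%:R%:E &
  exists e : 'I_n -> V, (forall i, eigenvector l (e i)) /\ free_for e.
Proof.
move=> lx; pose A := [set n : nat | exists e : 'I_n -> V,
    (forall i, eigenvector l (e i)) /\ free_for e].
have [||n An En] := @sup_nat_max A.
- by exists (fun=> 0); split; [case | apply: free_for0].
- by move=> n [e [he fe]]; apply: bounded; apply: (admissible_eigenvectors lx he).
- by exists n.
Qed.

(** Eigenvectors for distinct eigenvalues are orthogonal for [I] and, by the eigenvalue equation,
    for [E] as well. Concatenated free families therefore stay free, and the Rayleigh bounds add
    up. *)
Lemma admissible_eigen_union (s : seq R) (n_ : R -> nat) : uniq s ->
  (forall l, l \in s -> l <= x /\ exists e : 'I_(n_ l) -> V,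
     (forall i, eigenvector l (e i)) /\ free_for e) ->
  exists e : 'I_(\sum_(l <- s) n_ l) -> V,
   [/\ forall i, (exists2 l, l \in s & eigenvector l (e i)), free_for e &
    forall c : 'I__ -> R,
      E (lincomb c e) (lincomb c e) <= x * I (lincomb c e) (lincomb c e)].
Proof.
elim: s => [_ _|l s IH /= /andP[ls us] hs].
  rewrite big_nil; exists (fun=> 0); split=> [[]//||c]; first exact: free_for0.
  by case: sD => D0 _; rewrite /lincomb big_ord0 (form0l sD hE) // (form0l sD hI) // mulr0.
have [e [he fe Ee]] := IH us (fun l' l's => hs l' (@mem_behead _ (l :: s) _ l's)).
have [lx [f [hf ff]]] := hs l (mem_head _ _).
have De i : D (e i) by case: (he i) => ? _ [].
have Df i : D (f i) by case: (hf i).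
rewrite big_cons; set n := \sum_(l <- s) n_ l in e he fe Ee De *.
exists (fun i => match fintype.split i with inl a => f a | inr b => e b end).
have lincombE (c : 'I_(n_ l + n) -> R) : 
   lincomb c (fun i => match fintype.split i with inl a => f a | inr b => e b end) =
   lincomb (c \o @lshift (n_ l) n) f + lincomb (c \o @rshift (n_ l) n) e.
  rewrite /lincomb big_split_ord /=; congr (_ + _); apply: eq_bigr => i _.
    by rewrite -/(unsplit (inl i)) unsplitK.
  by rewrite -/(unsplit (inr i)) unsplitK.
have orth c d : I (lincomb c f) (lincomb d e) = 0.
  rewrite (form_suml sD hI) //; last exact: subspace_lincomb.
  rewrite big1 // => i _; rewrite (formC hI) //; last exact: subspace_lincomb.
  rewrite (form_suml sD hI) // big1 ?mulr0 // => j _.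
  have [l' l's hj] := he j; rewrite (eigenvector_orth _ hj (hf i)) ?mulr0 //.
  by apply: contraNneq ls => <-.
have orthE c d : E (lincomb c f) (lincomb d e) = 0.
  have [Dc ->] := eigenvector_lincomb c hf; last exact: subspace_lincomb.
  by rewrite orth mulr0.
split=> [i|c|c].
- case: (fintype.split i) => j; first by exists l; rewrite ?mem_head.
  by have [l' l's hj] := he j; exists l'; rewrite ?inE ?l's ?orbT.
- rewrite lincombE; set u := lincomb _ f; set v := lincomb _ e => h.
  have Du : D u by apply: subspace_lincomb.
  have Dv : D v by apply: subspace_lincomb.
  rewrite (form_sqrD sD hI) // orth mulr0 addr0 in h.
  have u0 := form_ge0 hI Du; have v0 := form_ge0 hI Dv.
  have fu : I u u = 0 by lra.
  have fv : I v v = 0 by lra.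
  move=> i; rewrite -(splitK i); case: (fintype.split i) => j /=.
    exact: (ff _ fu).
  exact: (fe _ fv).
- rewrite lincombE; set u := lincomb _ f; set v := lincomb _ e.
  have [Du /(_ _ Du) Eu] : eigenvector l u by apply: eigenvector_lincomb.
  have Dv : D v by apply: subspace_lincomb.
  rewrite (form_sqrD sD hI) // (form_sqrD sD hE) // orth orthE mulr0 !addr0 mulrDr.
  apply: lerD; last exact: Ee.
  by rewrite Eu; apply: ler_wpM2r => //; exact: (form_ge0 hI).
Qed.


(** Any finite partial sum of multiplicities is the size of a joined family of eigenvectors, and
    such a family is admissible. *)
Lemma eigencount_le M : (forall n, admissible x n -> (n <= M)%N) ->
  (eigencount x <= M%:R%:E)%E.
Proof.
move=> hM; apply: ge_ereal_sup => _ [A [finA subA] <-].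
pose P l n := eigenmultiplicity l = n%:R%:E /\
  exists e : 'I_n -> V, (forall i, eigenvector l (e i)) /\ free_for e.
pose n_ l := xget 0%N [set n | P l n].
have Pn l : l <= x -> P l (n_ l).
  by move=> lx; have [n ? ?] := eigenmultiplicity_max lx; apply: (@xgetPex _ 0%N [set n | P l n]); exists n.
have sx l : l \in fset_set A -> l <= x.
  by rewrite in_fset_set // inE => /subA[].
rewrite fsbig_finite //.
have [|l ls|e [he fe Ee]] := @admissible_eigen_union (fset_set A) n_.
- exact: fset_uniq.
- by split; [exact: sx | have [_] := Pn _ (sx _ ls)].
rewrite (eq_big_seq (fun l => (n_ l)%:R%:E)); last first.
  by move=> l ls; have [-> _] := Pn _ (sx _ ls).
rewrite sumEFin -natr_sum lee_fin ler_nat; apply: hM.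
by exists e; split=> // i; have [l _ []] := he i.
Qed.

(* Only the values of [f] and [l] at indices below [m] matter. *)
Definition eigensystem (f : nat -> V) (l : nat -> R) (m : nat) :=
  (forall i, (i < m)%N -> eigenvector (l i) (f i) /\ l i <= x) /\
  (forall i j, (i < m)%N -> (j < m)%N -> I (f i) (f j) = (i == j)%:R).

Lemma orthonormal_free n (e : 'I_n -> V) : (forall i, D (e i)) ->
  (forall i j, I (e i) (e j) = (i == j)%:R) -> free_for e.
Proof.
move=> De on c; rewrite (form_suml sD hI) //; last exact: subspace_lincomb.
under eq_bigr => i _.
  rewrite (formC hI) ?(form_suml sD hI) //; last exact: subspace_lincomb.
  rewrite (bigD1 i) //= on eqxx mulr1 big1 ?addr0; last first.
    by move=> j ji; rewrite on (negPf ji) mulr0.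
  over.
move=> /eqP; rewrite psumr_eq0 => [/allP h i|i _]; last by rewrite -expr2 sqr_ge0.
by have /h := mem_index_enum i; rewrite -expr2 sqrf_eq0 => /eqP.
Qed.

(** Indices are grouped by eigenvalue. Each group is an orthonormal family in one eigenspace, so its
    size is at most the multiplicity, and the sizes add up to [m]. *)
Lemma eigensystem_count f l m : eigensystem f l m -> (m%:R%:E <= eigencount x)%E.
Proof.
move=> [hf on].
pose s := undup [seq l (i : 'I_m) | i <- enum 'I_m].
have us : uniq s := undup_uniq _.
have sP (i : 'I_m) : l i \in s by rewrite mem_undup map_f // mem_enum.
have Ps l0 : l0 \in s -> exists i : 'I_m, l0 = l i.
  by rewrite mem_undup => /mapP[i _ ->]; exists i.
apply: esum_ge; exists [set` s]; first split=> [|l0 /= /Ps[i ->]].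
- exact: finite_seq.
- have [hi lx] := hf i (ltn_ord i); split=> //; exists (f i) => //.
  by rewrite on // eqxx; apply/eqP/oner_neq0.
rewrite -fsbig_seq //.
have -> : m%:R%:E = (\sum_(l0 <- s) (\sum_(i < m | l i == l0) 1)%:R%:E)%E :> \bar R.
  rewrite sumEFin -natr_sum; congr (_%:R%:E).
  under eq_bigr do rewrite big_mkcond.
  rewrite exchange_big /= -[LHS]card_ord -sum1_card; apply: eq_bigr => i _.
  rewrite -big_mkcond sum1_count (eq_count (a2 := pred1 (l i))); last first.
    by move=> l0; rewrite /= eq_sym.
  by rewrite count_uniq_mem // sP.
apply: lee_sum => l0 _.
pose A := [pred i : 'I_m | l i == l0].
pose e (j : 'I_#|A|) := f (nat_of_ord (enum_val j)).
have he (j : 'I_#|A|) : eigenvector l0 (e j).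
  have := enum_valP j; rewrite inE => /eqP <-.
  by have [] := hf (nat_of_ord (enum_val j)) (ltn_ord _).
apply: ereal_sup_ubound; exists #|A|; last by rewrite -sum1_card.
exists e; split=> //; apply: orthonormal_free => [j|j k]; first by case: (he j).
by rewrite on // (inj_eq (@ord_inj _)) (inj_eq enum_val_inj).
Qed.

(** The matrix of products I(e_i, f_j) has more rows than columns, hence a nonzero vector in its
    left kernel; freeness of [e] makes the resulting combination non-null. *)
Lemma orthogonal_complement_nontrivial n m (e : 'I_n -> V) (f : nat -> V) :
  (m < n)%N -> (forall i, D (e i)) -> (forall i, (i < m)%N -> D (f i)) -> free_for e ->
  exists c : 'I_n -> R, I (lincomb c e) (lincomb c e) != 0 /\
    forall i, (i < m)%N -> I (lincomb c e) (f i) = 0.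
Proof.
move=> mn De Df fe; pose A : 'M[R]_(n, m) := \matrix_(i, j) I (e i) (f j).
have : kermx A != 0.
  rewrite -mxrank_eq0 mxrank_ker subn_eq0 -ltnNge.
  exact: leq_ltn_trans (rank_leq_col A) mn.
case/rowV0Pn => v /sub_kermxP vA v0.
exists (v 0); split.
  apply: contraNneq v0 => /fe v0; apply/eqP/rowP => j; by rewrite v0 mxE.
move=> i im; rewrite (form_suml sD hI) //; last exact: Df.
have /rowP/(_ (Ordinal im)) := vA; rewrite [RHS]mxE mxE => vA0; rewrite -[RHS]vA0.
by apply: eq_bigr => j _; rewrite mxE.
Qed.

Lemma eigensystem_admissible f l m : eigensystem f l m -> admissible x m.
Proof.
move=> [hf on]; have Df i : (i < m)%N -> D (f i) by move=> im; have [[]] := hf i im.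
exists (fun i : 'I_m => f i); split=> [i|c|c].
- exact: Df.
- by apply: orthonormal_free => [i|i j]; [exact: Df | rewrite on].
have De (i : 'I_m) : D (f i) by exact: Df.
have DL : D (lincomb c (fun i : 'I_m => f i)) by exact: subspace_lincomb.
have IE (i : 'I_m) : I (f i) (lincomb c (fun i : 'I_m => f i)) = c i.
  rewrite (formC hI) // (form_suml sD hI) // (bigD1 i) //= on // eqxx mulr1 big1 ?addr0 //.
  by move=> j ji; rewrite on // (inj_eq (@ord_inj _)) (negPf ji) mulr0.
rewrite (form_suml sD hE) // (form_suml sD hI) // mulr_sumr; apply: ler_sum => i _.
have [[_ ->] // lx] := hf i (ltn_ord i); rewrite IE.
by rewrite mulrCA; apply: ler_wpM2r => //; rewrite -expr2 sqr_ge0.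
Qed.

(* The minimum of the Rayleigh quotient over the orthogonal complement of an
   eigensystem is attained, and gives one more eigenvector. *)
Lemma eigensystem_extend f l m u : eigensystem f l m -> D u ->
  (forall i, (i < m)%N -> I u (f i) = 0) -> I u u != 0 -> E u u <= x * I u u ->
  exists f' l', eigensystem f' l' m.+1.
Proof.
move=> sys Du ou Iu Eu; have [hf on] := sys.
have Df i : (i < m)%N -> D (f i) by move=> im; have [[]] := hf i im.
pose W := [set v | D v /\ forall i, (i < m)%N -> I v (f i) = 0].
pose Q := [set E v v | v in [set v | W v /\ I v v = 1]].
have Igt v : D v -> I v v != 0 -> 0 < I v v.
  by move=> Dv Iv; rewrite lt_neqAle eq_sym Iv; exact: (form_ge0 hI).
have WZ a v : W v -> W (a *: v).
  move=> [Dv ov]; split=> [|i im]; first exact: subspaceZ.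
  by rewrite (formZl sD hI) ?ov ?mulr0 //; exact: Df.
have normalize v : W v -> I v v != 0 ->
    let w := (Num.sqrt (I v v))^-1 *: v in [/\ W w, I w w = 1 & E w w = E v v / I v v].
  move=> Wv Iv w; have [Dv _] := Wv; split; first exact: WZ.
    rewrite (form_sqrZ sD hI) // exprVn sqr_sqrtr; last exact: (form_ge0 hI).
    by rewrite mulVf.
  rewrite (form_sqrZ sD hE) // exprVn sqr_sqrtr; last exact: (form_ge0 hI).
  by rewrite mulrC.
have [w0 [Ww0 Iw0 Ew0]] : exists w0, [/\ W w0, I w0 w0 = 1 & E w0 w0 <= x].
  have [|Ww Iw Ew] := normalize u _ Iu; first by split.
  exists ((Num.sqrt (I u u))^-1 *: u); split=> //.
  by rewrite Ew ler_pdivrMr //; exact: Igt.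
have hasQ : has_inf Q.
  split; first by exists (E w0 w0), w0.
  by exists 0 => _ [v [[Dv _] _] <-]; exact: (form_ge0 hE).
pose lam := inf Q.
have lamx : lam <= x by apply: le_trans Ew0; apply: ge_inf; [case: hasQ | exists w0].
have lamW v : W v -> lam * I v v <= E v v.
  move=> Wv; have [Dv _] := Wv; have [Iv|Iv] := eqVneq (I v v) 0.
    by rewrite Iv mulr0; exact: (form_ge0 hE).
  have [Ww Iw Ew] := normalize _ Wv Iv.
  rewrite -ler_pdivlMr; last exact: Igt.
  by rewrite -Ew; apply: ge_inf; [case: hasQ | exists ((Num.sqrt (I v v))^-1 *: v)].
have /choice[s hs] : forall n : nat, exists v, [/\ W v, I v v = 1 & E v v <= lam + n.+1%:R^-1].
  move=> n; have [|_ [v [Wv Iv] <-] ltv] := @inf_adherent _ Q n.+1%:R^-1 _ hasQ.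
    by rewrite invr_gt0 ltr0n.
  by exists v; split=> //; exact: ltW.
have [n|n|n|g [Dg Eg Ig og]] := @compact_form s lam.
- by have [[]] := hs n.
- by have [] := hs n.
- by have [] := hs n.
have Wg : W g.
  split=> // i im; apply: og; first exact: Df.
  by move=> n; have [[_ h] _ _] := hs n; exact: h.
(* Euler-Lagrange equation: the Rayleigh bound at g + tv is a quadratic inequality in t whose linear
   coefficient is twice E(g, v) - lam I(g, v). *)
have gW v : W v -> E g v = lam * I g v.
  move=> Wv; have [Dv _] := Wv; apply/eqP; rewrite -subr_eq0; apply/eqP.
  apply: (@quadratic_ge0_eq0 _ (E v v - lam * I v v)) => t.
  have Wt : W (g + t *: v).
    split=> [|i im]; first by apply: (subspaceD sD) => //; exact: subspaceZ.
    rewrite (formDl hI) //; [|exact: subspaceZ|exact: Df].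
    rewrite (formZl sD hI) //; last exact: Df.
    by case: Wg => _ ->; rewrite // add0r; case: Wv => _ ->; rewrite // mulr0.
  have := lamW _ Wt.
  have Dtv : D (t *: v) by exact: subspaceZ.
  rewrite (form_sqrD sD hI) // (form_sqrD sD hE) // (form_sqrZ sD hI) // (form_sqrZ sD hE) //.
  rewrite (formC hI Dg Dtv) (formC hE Dg Dtv) (formZl sD hI) // (formZl sD hE) //.
  rewrite (formC hI Dv Dg) (formC hE Dv Dg) Ig; lra.
(* To test against all of [D], [v] is split into its projection [p] onto the system and a remainder
   in [W]. Both forms vanish on (g, p), because the [f i] are eigenvectors orthogonal to [g]. *)
have eg : eigenvector lam g.
  split=> // v Dv; pose p := \sum_(i < m) I v (f i) *: f i.
  have Dfi (i : 'I_m) : D (f i) by exact: Df.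
  have Dp : D p by exact: (subspace_lincomb sD).
  have Wvp : W (v - p).
    split=> [|i im]; first exact: subspaceB.
    rewrite (formDl hI) //; [|by rewrite -scaleN1r; apply: subspaceZ|exact: Df].
    rewrite -scaleN1r (formZl sD hI) //; last exact: Df.
    rewrite (form_suml sD hI) //; last exact: Df.
    rewrite (bigD1 (Ordinal im)) //= on // eqxx mulr1 big1 ?addr0; first by ring.
    by move=> j ji; rewrite on // -(inj_eq (@ord_inj _)) /= in ji *; rewrite (negPf ji) mulr0.
  have Igp : I g p = 0.
    rewrite (formC hI) // (form_suml sD hI) // big1 // => i _.
    by rewrite [I (f i) g](formC hI) //; case: Wg => _ ->; rewrite ?mulr0.
  have Egp : E g p = 0.
    rewrite (formC hE) // (form_suml sD hE) // big1 // => i _.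
    have [[_ ->] // _] := hf i (ltn_ord i).
    by rewrite [I (f i) g](formC hI) //; case: Wg => _ ->; rewrite ?mulr0.
  have [Dvp _] := Wvp.
  rewrite -[v](subrK p) (formC hE) ?(formC hI Dg) //; last 2 first.
  - exact: subspaceD.
  - exact: subspaceD.
  rewrite (formDl hE) // (formDl hI) // (formC hE Dp) // (formC hI Dp) // Egp Igp !addr0.
  by rewrite (formC hE Dvp) // (formC hI Dvp) // gW.
exists (fun i => if (i < m)%N then f i else g), (fun i => if (i < m)%N then l i else lam).
split=> [i _|i j]; first by case: ifP => [/hf//|_]; split.
rewrite !ltnS => im jm; case: ifPn => [im'|]; case: ifPn => [jm'|].
- exact: on.
- rewrite -leqNgt => mj; have -> : j = m by apply/eqP; rewrite eqn_leq jm.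
  rewrite (ltn_eqF im') (formC hI) //; last exact: Df.
  by case: Wg => _ ->.
- rewrite -leqNgt => mi; have -> : i = m by apply/eqP; rewrite eqn_leq im.
  by rewrite (gtn_eqF jm'); case: Wg => _ ->.
- rewrite -!leqNgt => mj mi.
  have -> : i = j by apply/eqP; rewrite eqn_leq (leq_trans im) ?(leq_trans jm).
  by rewrite eqxx.
Qed.

(** If a longest eigensystem had m < n members, some non-null combination of the n given vectors
    would be orthogonal to it and, having Rayleigh quotient at most [x], would allow an
    extension. *)
Lemma eigencount_ge n : admissible x n -> (n%:R%:E <= eigencount x)%E.
Proof.
move=> [e [De fe Ee]].
have exS : exists m, `[< exists f l, eigensystem f l m >].
  by exists 0%N; apply/asboolP; exists (fun=> 0), (fun=> 0); split.
have bS m : `[< exists f l, eigensystem f l m >] -> (m <= N)%N.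
  by move=> /asboolP[f [l /eigensystem_admissible]]; exact: bounded.
case: (ex_maxnP exS bS) => m /asboolP[f [l sys]] mmax.
apply: le_trans (eigensystem_count sys); rewrite lee_fin ler_nat leqNgt; apply/negP => mn.
have Df i : (i < m)%N -> D (f i) by move=> im; have [hf _] := sys; have [[]] := hf i im.
have [c [Ic oc]] := orthogonal_complement_nontrivial mn De Df fe.
have [|f' [l' sys']] := eigensystem_extend sys _ oc Ic (Ee c).
  exact: subspace_lincomb.
have : (m.+1 <= m)%N by apply: mmax; apply/asboolP; exists f', l'.
by rewrite ltnn.
Qed.

Lemma admissible0 : admissible x 0.
Proof.
case: sD => D0 _.
exists (fun=> 0); split=> [//||c]; first exact: free_for0.
by rewrite /lincomb big_ord0 (form0l sD hE) // (form0l sD hI) // mulr0.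
Qed.

Lemma eigencountP : exists n, [/\ eigencount x = n%:R%:E, admissible x n &
  forall k, admissible x k -> (k <= n)%N].
Proof.
have exS : exists m, `[< admissible x m >] by exists 0%N; apply/asboolP/admissible0.
have bS m : `[< admissible x m >] -> (m <= N)%N by move=> /asboolP; exact: bounded.
case: (ex_maxnP exS bS) => n /asboolP an nmax.
have nmax' k : admissible x k -> (k <= n)%N by move=> /asboolP/nmax.
exists n; split=> //; apply/eqP; rewrite eq_le eigencount_ge // andbT.
exact: eigencount_le.
Qed.

End Bounded.
End SpectralCounting.

(** * Words and barycentric coordinates *)

Section Words.

Fixpoint words (m : nat) : seq (seq 'I_3) :=
  if m is m'.+1 then [seq i :: w | i <- enum 'I_3, w <- words m'] else [:: [::]].

Lemma mem_words m w : (w \in words m) = (size w == m).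
Proof.
elim: m w => [|m IH] [|a w] //=; rewrite ?inE //.
  by apply/allpairsP => -[[i v] []].
rewrite eqSS -IH; apply/allpairsP/idP => [[[i v] /= [_ h [_ ->]]] //|h].
by exists (a, w); rewrite mem_enum.
Qed.

Lemma uniq_words m : uniq (words m).
Proof.
elim: m => //= m IH; apply: allpairs_uniq => //; first exact: enum_uniq.
by move=> [i v] [j w] _ _ [-> ->].
Qed.

Lemma sum_words_cat (A : nmodType) k m (f : seq 'I_3 -> A) :
  \sum_(w <- words (k + m)) f w =
  \sum_(v <- words k) \sum_(w <- words m) f (v ++ w).
Proof.
elim: k f => [|k IH] f; first by rewrite [RHS]big_seq1.
rewrite addSn /= big_allpairs_dep big_allpairs_dep /=; apply: eq_bigr => i _.
exact: IH.
Qed.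

Lemma words1 : words 1 = [seq [:: i] | i <- enum 'I_3].
Proof. by rewrite /=; elim: (enum 'I_3) => //= a s ->. Qed.

Lemma sum_words_rcons (A : nmodType) m (f : seq 'I_3 -> A) :
  \sum_(w <- words m.+1) f w = \sum_(v <- words m) \sum_(i < 3) f (rcons v i).
Proof.
rewrite -[m.+1]addn1 sum_words_cat; apply: eq_bigr => v _.
rewrite words1 big_map big_enum; apply: eq_bigr => i _.
by rewrite cats1.
Qed.

Lemma size_words m : size (words m) = (3 ^ m)%N.
Proof. by elim: m => //= m IH; rewrite size_allpairs IH size_enum_ord expnS. Qed.

(** Words avoiding the letter 0 address the cells along the bottom line; two letters remain at each
    position. *)
Lemma count_bottom_words k : count [pred w | ord0 \notin w] (words k) = (2 ^ k)%N.
Proof.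
elim: k => //= k IH; rewrite -sum1_count big_mkcond big_allpairs_dep big_enum /=.
have sumw i : \sum_(w <- words k) (if ord0 \notin i :: w then 1 else 0)%N =
    if ord0 == i then 0%N else (2 ^ k)%N.
  under eq_bigr do rewrite inE negb_or.
  case: eqP => _ /=; first by rewrite big1.
  by rewrite -big_mkcond /= sum1_count.
rewrite (eq_bigr (fun i => if ord0 == i then 0%N else (2 ^ k)%N)) //.
by rewrite !big_ord_recl big_ord0 /= addn0 add0n expnS mul2n addnn.
Qed.

End Words.

(** * Barycentric coordinates and addresses of cells *)

Section Barycentric.
Context {R : realType}.
Local Notation plane := (R * R)%type.
Variable q : 'I_3 -> plane.
Hypothesis hq : equilateral q.

Definition cross (u v : plane) : R := u.1 * v.2 - u.2 * v.1.

(** Ratio of signed areas: the triangle with [x] in place of [q i] against the whole triangle.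
    Addition in ['I_3] is cyclic. *)
Definition bary (i : 'I_3) (x : plane) : R :=
  cross (q (i + 1) - x) (q (i + 2) - x) / cross (q 1 - q 0) (q 2 - q 0).

Lemma I3P (P : 'I_3 -> Prop) : P 0 -> P 1 -> P 2 -> forall i, P i.
Proof.
move=> P0 P1 P2; case=> [] [|[|[|//]]] h.
- by rewrite (_ : Ordinal h = 0) //; apply/val_inj.
- by rewrite (_ : Ordinal h = 1) //; apply/val_inj.
- by rewrite (_ : Ordinal h = 2) //; apply/val_inj.
Qed.

Lemma I3_eqs :
  (((0 + 1)%R = 1%R :> 'I_3) * ((0 + 2)%R = 2%R :> 'I_3) *
   ((1 + 1)%R = 2%R :> 'I_3) * ((1 + 2)%R = 0%R :> 'I_3) *
   ((2 + 1)%R = 0%R :> 'I_3) * ((2 + 2)%R = 1%R :> 'I_3))%type.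
Proof. by do !split; apply/val_inj. Qed.

Lemma sum_I3 (A : nmodType) (f : 'I_3 -> A) : \sum_i f i = f 0 + (f 1 + f 2).
Proof.
rewrite 3!big_ord_recl big_ord0 addr0; congr (f _ + (f _ + f _)); exact/val_inj.
Qed.

(** By Lagrange's identity, for side length s the squared cross product is s^4 minus the squared dot
    product (s^2/2)^2, which is positive. *)
Lemma cross_neq0 : cross (q 1 - q 0) (q 2 - q 0) != 0.
Proof.
case: hq => s s0 hs.
have h i j : i != j -> ((q i).1 - (q j).1) ^+ 2 + ((q i).2 - (q j).2) ^+ 2 = s ^+ 2.
  move=> ij; rewrite -(hs i j ij) /euclid_dist sqr_sqrtr //.
  by rewrite addr_ge0 // sqr_ge0.
have := h 1 0 isT; have := h 2 0 isT; have := h 2 1 isT; move: s0; rewrite /cross /=.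
case: (q 0) (q 1) (q 2) => [x0 y0] [x1 y1] [x2 y2] /=; clear h hs => s0 h21 h20 h10.
apply/eqP => d0.
have dot : (x1 - x0) * (x2 - x0) + (y1 - y0) * (y2 - y0) = s ^+ 2 / 2 by lra.
have lagrange : ((x1 - x0) ^+ 2 + (y1 - y0) ^+ 2) * ((x2 - x0) ^+ 2 + (y2 - y0) ^+ 2) =
  ((x1 - x0) * (x2 - x0) + (y1 - y0) * (y2 - y0)) ^+ 2 +
  ((x1 - x0) * (y2 - y0) - (y1 - y0) * (x2 - x0)) ^+ 2 by ring.
rewrite d0 dot h20 h10 in lagrange.
have : 0 < s ^+ 4 by rewrite exprn_gt0.
have -> : s ^+ 4 = s ^+ 2 * s ^+ 2 by ring.
lra.
Qed.

Lemma bary_ifs i j x : bary i (ifs q j x) = 2^-1 * (bary i x + (i == j)%:R).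
Proof.
have := cross_neq0; rewrite /bary /cross /ifs.
elim/I3P: i; elim/I3P: j; rewrite !I3_eqs /= ?eqxx;
  case: (q 0) (q 1) (q 2) x => [x0 y0] [x1 y1] [x2 y2] [x y] /= d0;
  rewrite /GRing.scale /=; field; exact: d0.
Qed.

Lemma bary_vertex i j : bary i (q j) = (i == j)%:R.
Proof.
have := cross_neq0; rewrite /bary /cross.
elim/I3P: i; elim/I3P: j; rewrite !I3_eqs /= ?eqxx;
  case: (q 0) (q 1) (q 2) => [x0 y0] [x1 y1] [x2 y2] /= d0; field; exact: d0.
Qed.

Lemma sum_bary x : bary 0 x + (bary 1 x + bary 2 x) = 1.
Proof.
have := cross_neq0; rewrite /bary /cross !I3_eqs.
case: (q 0) (q 1) (q 2) x => [x0 y0] [x1 y1] [x2 y2] [x y] /= d0; field; exact: d0.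
Qed.

Lemma bary_inj x y : (forall i, bary i x = bary i y) -> x = y.
Proof.
have baryE z : z = bary 0 z *: q 0 + (bary 1 z *: q 1 + bary 2 z *: q 2).
  have := cross_neq0; rewrite /bary /cross !I3_eqs.
  case: (q 0) (q 1) (q 2) z => [x0 y0] [x1 y1] [x2 y2] [z z'] /= d0.
  by apply: injective_projections => /=; rewrite /GRing.scale /=; rewrite -?[_ *: _]/(_ * _); field; exact: d0.
by move=> h; rewrite [x]baryE [y]baryE !h.
Qed.

Lemma ifs_inj i : injective (ifs q i).
Proof.
move=> x y /scalerI; rewrite invr_eq0 pnatr_eq0 => /(_ isT).
exact: addIr.
Qed.

Lemma ifs_word_inj w : injective (ifs_word q w).
Proof. by elim: w => //= i w IH x y /ifs_inj/IH. Qed.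

Lemma ifs_vertexC i j : ifs q i (q j) = ifs q j (q i).
Proof. by rewrite /ifs addrC. Qed.

Lemma ifs_vertex i : ifs q i (q i) = q i.
Proof.
by apply: injective_projections => /=; rewrite -[_ *: _]/(_ * _); field.
Qed.

Lemma ifs_word_cat v w x : ifs_word q (v ++ w) x = ifs_word q v (ifs_word q w x).
Proof. by rewrite /ifs_word foldr_cat. Qed.

Lemma ifs_word_rcons v i x : ifs_word q (rcons v i) x = ifs_word q v (ifs q i x).
Proof. by rewrite -cats1 ifs_word_cat. Qed.

Lemma ifs_wordB w x y : ifs_word q w x - ifs_word q w y = 2^-1 ^+ size w *: (x - y).
Proof.
elim: w => [|i w IH] /=; first by rewrite expr0 scale1r.
rewrite /ifs -scalerBr opprD addrACA subrr addr0 IH scalerA exprS.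
by [].
Qed.

Definition triangle : set plane := [set x | forall i, 0 <= bary i x].

Lemma triangle_le1 x i : triangle x -> bary i x <= 1.
Proof.
move=> tx; have := sum_bary x; have := tx 0; have := tx 1; have := tx 2.
by elim/I3P: i; lra.
Qed.

Lemma triangle_vertex j : triangle (q j).
Proof. by move=> i; rewrite bary_vertex. Qed.

Lemma triangle_ifs i x : triangle x -> triangle (ifs q i x).
Proof.
move=> tx j; rewrite bary_ifs mulr_ge0 ?invr_ge0 ?ler0n // addr_ge0 ?ler0n //.
Qed.

Lemma triangle_ifs_word w x : triangle x -> triangle (ifs_word q w x).
Proof. by move=> tx; elim: w => //= i w; apply: triangle_ifs. Qed.

(** Each map [ifs j] averages the coordinate with 0 or 1, and coordinates are at most 1 on the
    triangle, so the value 1 can only come from the value 1. *)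
Lemma bary_ifs_word_eq1 i w x : triangle x -> bary i (ifs_word q w x) = 1 -> bary i x = 1.
Proof.
move=> tx; elim: w => //= j w IH; rewrite bary_ifs => h; apply: IH.
have := triangle_le1 i (triangle_ifs_word w tx).
by move: h; case: (i == j) => /=; lra.
Qed.

Lemma triangle_bary_eq1 i x : triangle x -> bary i x = 1 -> x = q i.
Proof.
move=> tx bi; apply: bary_inj => j; rewrite bary_vertex.
have := sum_bary x; have := tx 0; have := tx 1; have := tx 2; move: bi.
by elim/I3P: i; elim/I3P: j => /=; rewrite ?eqxx /=; lra.
Qed.

(* Two distinct cells of one level can only meet at a vertex, which has
   different barycentric positions in the two cells. *)
Lemma ifs_word_eq w w' x : size w = size w' -> triangle x ->
  ifs_word q w x = ifs_word q w' x -> w = w'.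
Proof.
move=> + tx; elim: w w' => [|a w IH] [|a' w'] //= [sw] e.
have [aa|naa] := eqVneq a a'; first by rewrite -aa in e *; rewrite (IH w') //; exact: ifs_inj e.
have tw := triangle_ifs_word w tx; have tw' := triangle_ifs_word w' tx.
have ea := congr1 (bary a) e; have ea' := congr1 (bary a') e.
rewrite !bary_ifs eqxx (negPf naa) /= in ea.
rewrite !bary_ifs eqxx eq_sym (negPf naa) /= in ea'.
have h1 : bary a (ifs_word q w' x) = 1.
  by have := triangle_le1 a tw'; have := tw a; lra.
have h2 : bary a' (ifs_word q w x) = 1.
  by have := triangle_le1 a' tw; have := tw' a'; lra.
have xa := triangle_bary_eq1 tx (bary_ifs_word_eq1 tx h1).
have := bary_ifs_word_eq1 tx h2; rewrite xa bary_vertex eq_sym (negPf naa) => /eqP.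
by rewrite eq_sym oner_eq0.
Qed.

(** The difference of the endpoints, rescaled, is q_i - q_j, and these six vectors are distinct.
    This recovers the indices, after which one endpoint determines the word: an oriented edge
    belongs to exactly one cell. *)
Lemma ifs_word_edge w w' i j i' j' : i != j -> i' != j' -> size w = size w' ->
  ifs_word q w (q i) = ifs_word q w' (q i') ->
  ifs_word q w (q j) = ifs_word q w' (q j') -> [/\ w = w', i = i' & j = j'].
Proof.
move=> ij ij' sw ei ej.
have : 2^-1 ^+ size w *: (q i - q j) = 2^-1 ^+ size w' *: (q i' - q j').
  by rewrite -!ifs_wordB ei ej.
rewrite sw => /scalerI; rewrite expf_eq0 invr_eq0 pnatr_eq0 andbF => /(_ isT) d.
have baryB k x y : bary k (x - y + q 0) = bary k x - bary k y + bary k (q 0).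
  have := cross_neq0; rewrite /bary /cross.
  elim/I3P: k; rewrite !I3_eqs /=;
  case: (q 0) (q 1) (q 2) x y => [x0 y0] [x1 y1] [x2 y2] [x x'] [y y'] /= d0; field; exact: d0.
have bd k : (k == i)%:R - (k == j)%:R = (k == i')%:R - (k == j')%:R :> R.
  have := congr1 (fun z => bary k (z + q 0)) d.
  by rewrite /= !baryB !bary_vertex => /addIr.
have ii : i = i'.
  apply/eqP; have := bd i; rewrite eqxx (negPf ij) subr0.
  by case: (i == i') => //; case: (i == j') ; rewrite /= ?mulr1n ?mulr0n => h; exfalso; clear d sw ei ej; try clear ii; lra.
have jj : j = j'.
  apply/eqP; have := bd j; rewrite eqxx eq_sym (negPf ij) sub0r.
  by case: (j == j') => //; case: (j == i') ; rewrite /= ?mulr1n ?mulr0n => h; exfalso; clear d sw ei ej; try clear ii; lra.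
by split=> //; apply: (ifs_word_eq sw (triangle_vertex i)); rewrite ei ii.
Qed.

End Barycentric.

(** * Topology of the gasket *)

Section Gasket.
Context {R : realType}.
Local Notation plane := (R * R)%type.
Variables (q : 'I_3 -> plane) (SG : set plane).
Hypotheses (hq : equilateral q) (hSG : is_gasket q SG).

Lemma gasket_ifs i y : SG y -> SG (ifs q i y).
Proof. by case: hSG => _ _ e Sy; rewrite e; exists i => //; exists y. Qed.

Lemma gasket_preimage x : SG x -> exists i y, SG y /\ x = ifs q i y.
Proof. by case: hSG => _ _ e; rewrite e => -[i _ [y Sy <-]]; exists i, y; rewrite -e. Qed.

Lemma gasket_ifs_word w y : SG y -> SG (ifs_word q w y).
Proof. by move=> Sy; elim: w => //= i w; apply: gasket_ifs. Qed.

Lemma gasket_words k x : SG x -> exists w y, [/\ w \in words k, SG y & x = ifs_word q w y].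
Proof.
elim: k x => [|k IH] x Sx; first by exists [::], x; rewrite mem_words.
have [i [y [Sy ->]]] := gasket_preimage Sx; have [w [z [hw Sz ->]]] := IH y Sy.
by exists (i :: w), z; rewrite mem_words /= eqSS -mem_words.
Qed.

Lemma norm_ifs_wordB w x y :
  `|ifs_word q w x - ifs_word q w y| = 2^-1 ^+ size w * `|x - y|.
Proof. by rewrite ifs_wordB normrZ ger0_norm // exprn_ge0. Qed.

Lemma ifs_word_nonexpansive w x y :
  `|ifs_word q w x - ifs_word q w y| <= `|x - y|.
Proof. by rewrite norm_ifs_wordB ler_piMl // exprn_ile1 //; lra. Qed.

Lemma ifs_word_continuous w : continuous (ifs_word q w).
Proof.
move=> x; apply/cvgrPdist_lt => e e0; apply: filterS (nbhsx_ballx x e e0) => y.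
by rewrite -ball_normE; apply: le_lt_trans; exact: ifs_word_nonexpansive.
Qed.

Lemma bary_continuous i : continuous (bary q i).
Proof.
move=> x; rewrite /bary /cross.
have c1 (a : plane) : (fun x : plane => (a - x).1) @ x --> (a - x).1.
  by apply: cvgB; [exact: cvg_cst | exact: cvg_fst].
have c2 (a : plane) : (fun x : plane => (a - x).2) @ x --> (a - x).2.
  by apply: cvgB; [exact: cvg_cst | exact: cvg_snd].
apply: cvgM; last exact: cvg_cst.
  apply: cvgB; apply: cvgM; [exact: c1|exact: c2|exact: c2|exact: c1].
Qed.

(** By self-similarity the infimum m of a coordinate over the compact set [SG] satisfies m >= m/2,
    hence m >= 0. *)
Lemma gasket_triangle : SG `<=` triangle q.
Proof.
case: hSG => -[x0 Sx0] cSG _ x Sx i.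
have cimg : compact (bary q i @` SG).
  by apply: continuous_compact => //; apply: continuous_subspaceT; exact: bary_continuous.
have hinf : has_inf (bary q i @` SG).
  split; first by exists (bary q i x0), x0.
  have [M [_ hM]] := compact_bounded cimg.
  exists (- (M + 1)) => _ [y Sy <-].
  have /hM : M < M + 1 by lra.
  by move=> /(_ (bary q i y)) h; have := h (ex_intro2 _ _ y Sy erefl); rewrite /= ler_norml => /andP[].
have inf0 : 0 <= inf (bary q i @` SG).
  suff : inf (bary q i @` SG) / 2 <= inf (bary q i @` SG) by lra.
  apply: lb_le_inf; first by case: hinf.
  move=> _ [y Sy <-]; have [j [z [Sz ->]]] := gasket_preimage Sy.
  rewrite (bary_ifs hq).
  have : inf (bary q i @` SG) <= bary q i z by apply: ge_inf; [case: hinf | exists z].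
  by have : 0 <= (i == j)%:R :> R by []; lra.
by apply: le_trans inf0 _; apply: ge_inf; [case: hinf | exists x].
Qed.

Lemma gasket_bounded : exists2 M, 0 < M & forall x y, SG x -> SG y -> `|x - y| <= M.
Proof.
case: hSG => _ cSG _; have [M [_ hM]] := compact_bounded cSG.
exists (2 * (`|M| + 1)); first by have := normr_ge0 M; lra.
have h x : SG x -> `|x| <= `|M| + 1.
  by move=> Sx; apply: hM => //; have := ler_norm M; lra.
move=> x y /h hx /h hy; apply: le_trans (ler_normB _ _) _; lra.
Qed.

Lemma geometric_lt (M e : R) : 0 < e -> exists n : nat, 2^-1 ^+ n * M < e.
Proof.
move=> e0; have : (fun n => M * 2^-1 ^+ n) @ \oo --> (0 : R).
  by apply: cvg_geometric; rewrite ger0_norm; lra.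
move=> /cvgrPdist_lt/(_ e e0)[n _ hn]; exists n.
have := hn n (leqnn n); rewrite sub0r normrN mulrC; apply: le_lt_trans.
exact: ler_norm.
Qed.

Lemma gasket_closed : closed SG.
Proof. by case: hSG => _ cSG _; apply: compact_closed. Qed.

(** [q i] is the fixed point of the contraction [ifs i], so the iterates of any point of [SG] under
    this map converge to [q i], and [SG] is closed. *)
Lemma gasket_vertex i : SG (q i).
Proof.
apply: gasket_closed => B /nbhs_ballP[e /= e0 hB].
case: hSG => -[x0 Sx0] _ _.
have [n hn] := geometric_lt `|x0 - q i| e0.
exists (ifs_word q (nseq n i) x0); split; first exact: gasket_ifs_word.
apply: hB; have -> : q i = ifs_word q (nseq n i) (q i).
  by elim: n {hn} => //= n <-; rewrite (ifs_vertex q).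
by rewrite -ball_normE /= norm_ifs_wordB size_nseq distrC.
Qed.

Lemma within_continuous_dist (u : plane -> R) : {within SG, continuous u} ->
  forall x e, SG x -> 0 < e -> exists2 d, 0 < d &
    forall y, SG y -> `|x - y| < d -> `|u x - u y| < e.
Proof.
move=> /subspace_continuousP cu x e Sx e0.
have /cvgrPdist_lt/(_ e e0) := cu x Sx.
rewrite near_withinE => /nbhs_ballP[d /= d0 hd]; exists d => // y Sy xy.
by apply: hd => //; rewrite -ball_normE.
Qed.

Lemma within_continuous_ifs_word (u : plane -> R) w : {within SG, continuous u} ->
  {within SG, continuous (u \o ifs_word q w)}.
Proof.
move=> cu; apply/subspace_continuousP => x Sx; apply/cvgrPdist_lt => e e0.
have [d d0 hd] := within_continuous_dist cu (gasket_ifs_word w Sx) e0.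
rewrite near_withinE; apply/nbhs_ballP; exists d => // y; rewrite -ball_normE /= => xy Sy.
apply: hd; first exact: gasket_ifs_word.
apply: le_lt_trans xy; exact: ifs_word_nonexpansive.
Qed.

Lemma within_continuousP (u : plane -> R) :
  (forall x e, SG x -> 0 < e -> exists2 d, 0 < d &
    forall y, SG y -> `|x - y| < d -> `|u x - u y| < e) ->
  {within SG, continuous u}.
Proof.
move=> h; apply/subspace_continuousP => x Sx; apply/cvgrPdist_lt => e e0.
have [d d0 hd] := h x e Sx e0.
by rewrite near_withinE; apply/nbhs_ballP; exists d => // y; rewrite -ball_normE /= => xy Sy; apply: hd.
Qed.

End Gasket.

(** * Graph energies *)

Lemma cvg_sum_seq {R : realType} (T J : Type) (F : set_system T) (FF : Filter F)
    (r : seq J) (f : J -> T -> R) (l : J -> R) :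
  (forall j, f j @ F --> l j) ->
  (fun x => \sum_(j <- r) f j x) @ F --> \sum_(j <- r) l j.
Proof.
move=> h; elim: r => [|j r IH].
  by rewrite big_nil; under eq_fun do rewrite big_nil; exact: cvg_cst.
by rewrite big_cons; under eq_fun do rewrite big_cons; apply: cvgD.
Qed.

Lemma cvgn_unique {R : realType} (s t : nat -> R) (a b : R) : s @ \oo --> a -> t @ \oo --> b ->
  s = t -> a = b.
Proof. by move=> sa + st; rewrite -st => sb; rewrite -(cvg_lim _ sa) // -(cvg_lim _ sb). Qed.

Section Energy.
Context {R : realType}.
Local Notation plane := (R * R)%type.
Variable q : 'I_3 -> plane.
Hypothesis hq : equilateral q.
Implicit Types u v : plane -> R.

Definition cell_form u v : R :=
  (u (q 0) - u (q 1)) * (v (q 0) - v (q 1)) +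
  ((u (q 1) - u (q 2)) * (v (q 1) - v (q 2)) +
   (u (q 0) - u (q 2)) * (v (q 0) - v (q 2))).

(** The polarized graph energy, summed over cells rather than edges, so that self-similarity becomes
    a splitting of words. *)
Definition level_form (m : nat) u v : R :=
  (5 / 3) ^+ m * \sum_(w <- words m) cell_form (u \o ifs_word q w) (v \o ifs_word q w).

(** By [ifs_word_edge], ordered adjacent pairs correspond bijectively to a word of length m with an
    ordered pair of distinct indices. The six pairs in [P] count each side of a cell twice, which
    cancels the factor 1/2. *)
Lemma graph_energyE m u : graph_energy q m u = level_form m u u.
Proof.
rewrite /graph_energy /level_form; congr (_ * _).
pose P : seq ('I_3 * 'I_3) := [:: (0, 1); (1, 0); (1, 2); (2, 1); (0, 2); (2, 0)].
pose h (w : seq 'I_3) (p : 'I_3 * 'I_3) := (ifs_word q w (q p.1), ifs_word q w (q p.2)).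
have Pneq p : p \in P -> p.1 != p.2.
  by rewrite !inE => /or4P[|||/or3P[]] /eqP ->.
have inP i j : i != j -> (i, j) \in P.
  by elim/I3P: i; elim/I3P: j; rewrite ?eqxx.
pose r := [seq h w p | w <- words m, p <- P].
have ur : uniq r.
  apply: allpairs_uniq; rewrite ?uniq_words //.
  have inS x : x \in [seq (w, p) | w <- words m, p <- P] -> x.1 \in words m /\ x.2 \in P.
    by case/allpairsP => -[w p] /= [hw hp ->].
  move=> [w p] [w' p'] /inS[/= hw hp] /inS[/= hw' hp'] [e1 e2].
  move: hw hw'; rewrite !mem_words => /eqP sw /eqP sw'.
  have [|-> e3 e4] := ifs_word_edge hq (Pneq _ hp) (Pneq _ hp') _ e1 e2.
    by rewrite sw sw'.
  by rewrite (surjective_pairing p) (surjective_pairing p') e3 e4.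
have -> : [set p : plane * plane | Defs.adjacent q m p.1 p.2] = [set` r].
  apply/seteqP; split=> [[x y] /= [xy [w [sw [_ [i _ <-] ex] [_ [j _ <-] ey]]]]|].
    apply/allpairsP; exists (w, (i, j)); split; first by rewrite mem_words sw.
      by apply: inP; apply/eqP => ij; apply: xy; rewrite -ex -ey ij.
    by rewrite /h /= ex ey.
  move=> [x y] /= /allpairsP[[w [i j]] /= [hw hp [-> ->]]]; split.
    have /= /negPf ij := Pneq _ hp.
    move/ifs_word_inj/(congr1 (bary q i)); rewrite !(bary_vertex hq) eqxx ij => /eqP.
    by rewrite oner_eq0.
  exists w; split; first by apply/eqP; rewrite -mem_words.
    by exists (q i) => //; exists i.
  by exists (q j) => //; exists j.
rewrite -fsbig_seq // big_allpairs_dep /= mulr_sumr; apply: eq_bigr => w _.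
by rewrite !big_cons big_nil /cell_form /=; field.
Qed.

Lemma cell_form_ge0 u : 0 <= cell_form u u.
Proof. by rewrite /cell_form -!expr2 !addr_ge0 ?sqr_ge0. Qed.

Lemma level_form_ge0 m u : 0 <= level_form m u u.
Proof.
rewrite /level_form mulr_ge0 ?exprn_ge0 //.
by apply: sumr_ge0 => w _; exact: cell_form_ge0.
Qed.

Lemma level_formC m u v : level_form m u v = level_form m v u.
Proof.
by congr (_ * _); apply: eq_bigr => w _; rewrite /cell_form /=; ring.
Qed.

Lemma level_formP m a u v w :
  level_form m (a *: u + v) w = a * level_form m u w + level_form m v w.
Proof.
rewrite /level_form mulrCA -mulrDr; congr (_ * _).
rewrite mulr_sumr -big_split /=; apply: eq_bigr => s _; rewrite /cell_form /=.
rewrite !(fctE, scalrfctE) /= -![a *: _]/(a * _); ring.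
Qed.

Lemma level_form_cat k m u v : level_form (k + m) u v =
  (5 / 3) ^+ k * \sum_(w <- words k) level_form m (u \o ifs_word q w) (v \o ifs_word q w).
Proof.
rewrite /level_form exprD -mulrA; congr (_ * _).
rewrite sum_words_cat mulr_sumr; apply: eq_bigr => w _; congr (_ * _).
by apply: eq_bigr => w' _; congr cell_form; apply/funext => x /=; rewrite ifs_word_cat.
Qed.

(* The minimum of the energy over the values at the three midpoints is [3/5]
   of the energy of the cell. *)
Lemma cell_form_refine u :
  cell_form u u <= (5 / 3) * \sum_(i < 3) cell_form (u \o ifs q i) (u \o ifs q i).
Proof.
rewrite sum_I3 /cell_form /= !(ifs_vertex q) (ifs_vertexC q 1 0) (ifs_vertexC q 2 0)
  (ifs_vertexC q 2 1).
set a := u (q 0); set b := u (q 1); set c := u (q 2).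
set x := u (ifs q 1 (q 2)); set y := u (ifs q 0 (q 2)); set z := u (ifs q 0 (q 1)).
(* Deviations from the harmonic extension: a midpoint gets 2/5 of each adjacent and 1/5 of the
   opposite vertex value. In these variables the excess energy is a sum of squares. *)
pose X := x - (2 * b + 2 * c + a) / 5.
pose Y := y - (2 * a + 2 * c + b) / 5.
pose Z := z - (2 * a + 2 * b + c) / 5.
rewrite -subr_ge0; set lhs := (X in 0 <= X).
have -> : lhs = (5 / 3) * (2 * X ^+ 2 + 2 * Y ^+ 2 + 2 * Z ^+ 2 +
   (X - Y) ^+ 2 + (Y - Z) ^+ 2 + (X - Z) ^+ 2).
  by rewrite /lhs /X /Y /Z; field.
have := sqr_ge0 X; have := sqr_ge0 Y; have := sqr_ge0 Z; have := sqr_ge0 (X - Y).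
have := sqr_ge0 (Y - Z); have := sqr_ge0 (X - Z); lra.
Qed.

Lemma level_form_nondecreasing u : nondecreasing_seq (fun m => level_form m u u).
Proof.
apply/nondecreasing_seqP => m.
rewrite /level_form exprSr -mulrA; apply: ler_wpM2l; first exact: exprn_ge0.
rewrite sum_words_rcons mulr_sumr; apply: ler_sum => w _.
apply: le_trans (cell_form_refine _) _; apply: ler_wpM2l; first by lra.
apply: ler_sum => i _; rewrite le_eqVlt; apply/orP; left; apply/eqP.
by congr cell_form; apply/funext => x /=; rewrite ifs_word_rcons.
Qed.

Definition bounded_energy u := exists M, forall m, level_form m u u <= M.

Definition limit_energy u : R := fine (energy q u).

Lemma energyE u : energy q u = limn (fun m => (level_form m u u)%:E).
Proof.
rewrite /energy (_ : (fun m => (graph_energy q m u)%:E) = fun m => (level_form m u u)%:E) //.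
by apply/funext => m; rewrite graph_energyE.
Qed.

Lemma level_form_le_energy m u : ((level_form m u u)%:E <= energy q u)%E.
Proof.
rewrite energyE; have nd : nondecreasing_seq (fun m => (level_form m u u)%:E).
  by move=> i j ij; rewrite lee_fin; exact: level_form_nondecreasing.
rewrite (cvg_lim _ (ereal_nondecreasing_cvgn nd)) //.
by apply: ereal_sup_ubound; exists m.
Qed.

Lemma energy_le M u : (forall m, level_form m u u <= M) -> (energy q u <= M%:E)%E.
Proof.
move=> hM; rewrite energyE; have nd : nondecreasing_seq (fun m => (level_form m u u)%:E).
  by move=> i j ij; rewrite lee_fin; exact: level_form_nondecreasing.
rewrite (cvg_lim _ (ereal_nondecreasing_cvgn nd)) //.
by apply: ge_ereal_sup => _ [m _ <-]; rewrite lee_fin.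
Qed.

Lemma energy_ge0 u : (0 <= energy q u)%E.
Proof. by apply: le_trans (level_form_le_energy 0 u); rewrite lee_fin level_form_ge0. Qed.

Lemma bounded_energyP u : (energy q u < +oo)%E <-> bounded_energy u.
Proof.
split=> [ltoo|[M hM]]; last by apply: le_lt_trans (energy_le hM) _; rewrite ltry.
exists (limit_energy u) => m; rewrite -lee_fin fineK ?ge0_fin_numE ?energy_ge0 //.
exact: level_form_le_energy.
Qed.

Lemma energy_fin u : bounded_energy u -> energy q u = (limit_energy u)%:E.
Proof. by move=> /bounded_energyP ltoo; rewrite fineK // ge0_fin_numE ?energy_ge0. Qed.

Lemma level_form_le m u : bounded_energy u -> level_form m u u <= limit_energy u.
Proof. by move=> bu; rewrite -lee_fin -energy_fin // level_form_le_energy. Qed.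

Lemma limit_energy_le M u : (forall m, level_form m u u <= M) -> limit_energy u <= M.
Proof.
move=> hM; rewrite -lee_fin -energy_fin; last by exists M.
exact: energy_le.
Qed.

Lemma limit_energy_ge0 u : 0 <= limit_energy u.
Proof. by rewrite fine_ge0 // energy_ge0. Qed.

Lemma level_form_cvg u : bounded_energy u ->
  (fun m => level_form m u u) @ \oo --> limit_energy u.
Proof.
move=> bu; have nd := level_form_nondecreasing u.
have ub : has_ubound (range (fun m => level_form m u u)).
  by case: bu => M hM; exists M => _ [m _ <-].
suff -> : limit_energy u = sup (range (fun m => level_form m u u)).
  exact: nondecreasing_cvgn.
apply/eqP; rewrite eq_le; apply/andP; split.
  by apply: limit_energy_le => m; apply: ub_le_sup => //; exists m.
by apply: ge_sup => [|_ [m _ <-]]; [exists (level_form 0 u u), 0%N | exact: level_form_le].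
Qed.

Lemma level_formN m u v : level_form m (- u) v = - level_form m u v.
Proof.
have := level_formP m (-1) u 0 v; rewrite addr0 scaleN1r mulN1r => ->.
suff -> : level_form m 0 v = 0 by rewrite addr0.
have := level_formP m 1 0 0 v; rewrite scaler0 addr0 mul1r => /eqP.
by rewrite -subr_eq0 opprD addNKr oppr_eq0 => /eqP.
Qed.

Lemma level_formD m u v w : level_form m (u + v) w = level_form m u w + level_form m v w.
Proof. by have := level_formP m 1 u v w; rewrite scale1r mul1r. Qed.

Lemma level_form_sqrD m u v :
  level_form m (u + v) (u + v) = level_form m u u + 2 * level_form m u v + level_form m v v.
Proof.
rewrite level_formD (level_formC m u (u + v)) (level_formC m v (u + v)) !level_formD.
rewrite (level_formC m v u); ring.
Qed.

Lemma level_form_sqrB m u v :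
  level_form m (u - v) (u - v) = level_form m u u - 2 * level_form m u v + level_form m v v.
Proof.
rewrite level_form_sqrD level_formN (level_formC m u (- v)) (level_formC m v (- v)).
rewrite !level_formN (level_formC m v u); ring.
Qed.

Lemma bounded_energyZ a u : bounded_energy u -> bounded_energy (a *: u).
Proof.
move=> [M hM]; exists (a ^+ 2 * M) => m.
have := level_formP m a u 0; rewrite addr0 => h.
have z w : level_form m 0 w = 0.
  have := level_formP m 1 0 0 w; rewrite scaler0 addr0 mul1r => /eqP.
  by rewrite -subr_eq0 opprD addNKr oppr_eq0 => /eqP.
rewrite h z addr0 level_formC h z addr0 mulrA -expr2.
by apply: ler_wpM2l => //; exact: sqr_ge0.
Qed.

Lemma bounded_energyD u v : bounded_energy u -> bounded_energy v -> bounded_energy (u + v).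
Proof.
move=> [M hM] [N hN]; exists (2 * M + 2 * N) => m.
have := level_form_ge0 m (u - v); rewrite level_form_sqrB level_form_sqrD.
have := hM m; have := hN m; lra.
Qed.

Lemma bounded_energyN u : bounded_energy u -> bounded_energy (- u).
Proof. by rewrite -scaleN1r; apply: bounded_energyZ. Qed.

Lemma bounded_energy0 : bounded_energy 0.
Proof.
exists 0 => m; have := level_formP m 1 0 0 0; rewrite scaler0 addr0 mul1r => /eqP.
by rewrite -subr_eq0 opprD addNKr oppr_eq0 => /eqP ->.
Qed.

(** Polarization writes the level form through two diagonal ones, whose limits are energies.
    Symmetry and bilinearity can then be passed to the limit. *)
Lemma level_form_cvg_energy_form u v : bounded_energy u -> bounded_energy v ->
  (fun m => level_form m u v) @ \oo --> energy_form q u v.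
Proof.
move=> bu bv.
have -> : (fun m => level_form m u v) = (fun m => 4^-1 *
    (level_form m (u + v) (u + v) - level_form m (u - v) (u - v))).
  by apply/funext => m; rewrite level_form_sqrD level_form_sqrB; field.
apply: cvgM; first exact: cvg_cst.
apply: cvgB; apply: level_form_cvg; apply: bounded_energyD => //.
exact: bounded_energyN.
Qed.

Lemma energy_form_sqr u : bounded_energy u -> energy_form q u u = limit_energy u.
Proof.
move=> bu; apply: (cvgn_unique (level_form_cvg_energy_form bu bu) (level_form_cvg bu)).
by [].
Qed.

Lemma energy_formC u v : bounded_energy u -> bounded_energy v ->
  energy_form q u v = energy_form q v u.
Proof.
move=> bu bv.
apply: (cvgn_unique (level_form_cvg_energy_form bu bv) (level_form_cvg_energy_form bv bu)).
by apply/funext => m; exact: level_formC.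
Qed.

Lemma energy_formP a u v w : bounded_energy u -> bounded_energy v -> bounded_energy w ->
  energy_form q (a *: u + v) w = a * energy_form q u w + energy_form q v w.
Proof.
move=> bu bv bw.
have bauv : bounded_energy (a *: u + v) by apply: bounded_energyD => //; exact: bounded_energyZ.
have hr : (fun m => a * level_form m u w + level_form m v w) @ \oo -->
    a * energy_form q u w + energy_form q v w.
  apply: cvgD; last exact: level_form_cvg_energy_form.
  by apply: cvgM; [exact: cvg_cst | exact: level_form_cvg_energy_form].
apply: (cvgn_unique (level_form_cvg_energy_form bauv bw) hr).
by apply/funext => m; exact: level_formP.
Qed.

Lemma bounded_energy_ifs_word u w : bounded_energy u -> bounded_energy (u \o ifs_word q w).
Proof.
move=> [M hM]; exists ((5 / 3) ^- size w * M) => m.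
have p0 : 0 < (5 / 3 : R) ^+ size w by rewrite exprn_gt0 // divr_gt0.
rewrite mulrC ler_pdivlMr // mulrC; apply: le_trans (hM (size w + m)%N).
rewrite level_form_cat; apply: ler_wpM2l; first exact: ltW.
have wm : w \in words (size w) by rewrite mem_words.
rewrite (bigD1_seq w) ?uniq_words //= lerDl.
by apply: sumr_ge0 => w' _; exact: level_form_ge0.
Qed.

Lemma limit_energy_cat k u : bounded_energy u ->
  limit_energy u = (5 / 3) ^+ k * \sum_(w <- words k) limit_energy (u \o ifs_word q w).
Proof.
move=> bu; have h := level_form_cvg bu; rewrite -(cvg_shiftn k) in h.
have hr : (fun m => (5 / 3) ^+ k *
      \sum_(w <- words k) level_form m (u \o ifs_word q w) (u \o ifs_word q w)) @ \oo -->
    (5 / 3) ^+ k * \sum_(w <- words k) limit_energy (u \o ifs_word q w).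
  apply: cvgM; first exact: cvg_cst.
  by apply: cvg_sum_seq => w; apply: level_form_cvg; exact: bounded_energy_ifs_word.
by apply: (cvgn_unique h hr); apply/funext => m; rewrite /= addnC level_form_cat.
Qed.

End Energy.

(** * The self-similar measure and the oscillation estimate *)

Lemma ball_rat {R : realType} (y r : R) : 0 < r -> exists a : rat, ball (ratr a : R) r y.
Proof.
move=> r0; have [a] := @rat_in_itvoo R (y - r) (y + r) ltac:(lra).
by rewrite in_itv /= => /andP[h1 h2]; exists a; rewrite -ball_normE /= ltr_norml; lra.
Qed.

Lemma ball_sub_ball2 {R : realType} (c r e x y : R) : r < e / 2 -> ball c r x -> ball c r y ->
  ball x e y.
Proof.
rewrite -!ball_normE /= !ltr_norml => re /andP[h1 h2] /andP[h3 h4].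
by apply/andP; split; lra.
Qed.

(** The boxes with rational centres and radii 1/(n+1) are countably many and measurable for the
    product sigma-algebra, and an open set is the union of those it contains. *)
Lemma open_measurable_prod {R : realType} (O : set (R * R)) : open O -> measurable O.
Proof.
move=> oO; pose box (t : rat * rat * nat) : set (R * R) :=
  ball (ratr t.1.1 : R) t.2.+1%:R^-1 `*` ball (ratr t.1.2 : R) t.2.+1%:R^-1.
have -> : O = \bigcup_t (if `[< box t `<=` O >] then box t else set0).
  apply/seteqP; split=> [x Ox|x [t _]]; last by case: asboolP => // h /h.
  have /nbhs_ballP[e /= e0 he] := open_nbhs_nbhs (conj oO Ox).
  have [n hn] : exists n : nat, n.+1%:R^-1 < e / 2.
    have [n] := @near_infty_natSinv_lt R (PosNum (divr_gt0 e0 (ltr0Sn _ 1))).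
    by move=> _ /(_ n (leqnn n)) /= h; exists n.
  have n0 : 0 < n.+1%:R^-1 :> R by rewrite invr_gt0.
  have [a ha] := ball_rat x.1 n0; have [b hb] := ball_rat x.2 n0.
  exists (a, b, n) => //; case: asboolP => //= -[]; move=> y [/= ya yb]; apply: he.
  by split; [exact: ball_sub_ball2 hn ha ya | exact: ball_sub_ball2 hn hb yb].
apply: countable_bigcupT_measurable => // t; case: ifP => _; last exact: measurable0.
by apply: measurableX; apply: open_measurable; exact: ball_open.
Qed.

Lemma compact_measurable_prod {R : realType} (A : set (R * R)) : compact A -> measurable A.
Proof.
move=> cA; rewrite -[A]setCK; apply: measurableC; apply: open_measurable_prod.
by apply: closed_openC; apply: compact_closed.
Qed.

Lemma within_continuous_measurable_prod {R : realType} (A : set (R * R)) (u : R * R -> R) :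
  measurable A -> {within A, continuous u} -> measurable_fun A u.
Proof.
move=> mA /continuousP cu; apply: (measurability _ (RGenOpens.measurableE R)).
move=> _ [_ [a [b ->] <-]].
have oI : open `]a, b[%classic by exact: interval_open.
have oU := cu _ oI.
have /open_subspaceP[V oV VA] := oU.
by rewrite setIC -VA; apply: measurableI => //; exact: open_measurable_prod.
Qed.

Section WithinContinuousAlgebra.
Context {R : realType} (A : set (R * R)).
Implicit Types u v : R * R -> R.

Lemma within_continuousD u v : {within A, continuous u} -> {within A, continuous v} ->
  {within A, continuous (u + v)}.
Proof. by move=> cu cv x; apply: cvgD; [exact: cu | exact: cv]. Qed.

Lemma within_continuousM u v : {within A, continuous u} -> {within A, continuous v} ->
  {within A, continuous (fun x => u x * v x)}.
Proof. by move=> cu cv x; apply: cvgM; [exact: cu | exact: cv]. Qed.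

Lemma within_continuousZ a u : {within A, continuous u} -> {within A, continuous (a *: u)}.
Proof. by move=> cu x; apply: cvgM; [exact: cvg_cst | exact: cu]. Qed.

Lemma within_continuous0 : {within A, continuous (0 : R * R -> R)}.
Proof. by move=> x; exact: cvg_cst. Qed.

End WithinContinuousAlgebra.

(** * Integration over the gasket and oscillation of functions of finite energy *)

Section GasketMeasure.
Context {R : realType}.
Local Notation plane := (R * R)%type.
Variables (q : 'I_3 -> plane) (SG : set plane) (mu : probability plane R).
Hypotheses (hq : equilateral q) (hSG : is_gasket q SG) (hmu : is_gasket_measure q SG mu).
Implicit Types u v : plane -> R.

Lemma measurable_cell w : measurable (ifs_word q w @` SG).
Proof.
apply: compact_measurable_prod; apply: continuous_compact; last by case: hSG.
by apply: continuous_subspaceT; exact: ifs_word_continuous.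
Qed.

Lemma measurable_gasket : measurable SG.
Proof. by apply: compact_measurable_prod; case: hSG. Qed.

Lemma gasket_integrable u : {within SG, continuous u} -> mu.-integrable SG (EFin \o u).
Proof.
move=> cu; apply: measurable_bounded_integrable.
- exact: measurable_gasket.
- by apply: le_lt_trans (probability_le1 _ _) _; [exact: measurable_gasket | rewrite ltry].
- exact: within_continuous_measurable_prod measurable_gasket cu.
have [_ cSG _] := hSG; have [M [Mr hM]] := compact_bounded (continuous_compact cu cSG).
by exists M; split=> // N MN x Sx; apply: (hM N MN); exists x.
Qed.

Definition gasket_inner u v : R := \int[mu]_(x in SG) (u x * v x).

Lemma gasket_innerC u v : gasket_inner u v = gasket_inner v u.
Proof. by apply: eq_Rintegral => x _; rewrite mulrC. Qed.

Lemma gasket_inner_ge0 u : 0 <= gasket_inner u u.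
Proof. by apply: Rintegral_ge0 => x _; rewrite -expr2 sqr_ge0. Qed.

Lemma gasket_innerP a u v w : {within SG, continuous u} -> {within SG, continuous v} ->
  {within SG, continuous w} ->
  gasket_inner (a *: u + v) w = a * gasket_inner u w + gasket_inner v w.
Proof.
move=> cu cv cw; have mS := measurable_gasket.
have iu := gasket_integrable (within_continuousM cu cw).
have iv := gasket_integrable (within_continuousM cv cw).
rewrite /gasket_inner -RintegralZl // -RintegralD //; last first.
  apply: gasket_integrable; exact: (within_continuousZ (within_continuousM cu cw)).
by apply: eq_Rintegral => x _; rewrite !fctE mulrDl -mulrA.
Qed.

Lemma gasket_indicator_integral w :
  mu.-integrable SG (EFin \o \1_(ifs_word q w @` SG)) /\
  \int[mu]_(x in SG) \1_(ifs_word q w @` SG) x = (3 ^+ size w)^-1.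
Proof.
have mw := measurable_cell w; have mS := measurable_gasket; split.
  apply: measurable_bounded_integrable => //.
  - by apply: le_lt_trans (probability_le1 _ _) _; rewrite ?ltry.
  exists 1; split=> // M M1 x _ /=; apply: le_trans (ltW M1).
  by rewrite ger0_norm // indicE; case: (_ \in _).
rewrite /Rintegral integral_indic //= setIidl ?hmu //.
by move=> _ [y Sy <-]; exact: gasket_ifs_word.
Qed.

Lemma gasket_cells_integral (s : seq (seq 'I_3)) (M : seq 'I_3 -> R) :
  let f x := \sum_(w <- s) M w * \1_(ifs_word q w @` SG) x in
  mu.-integrable SG (EFin \o f) /\
  \int[mu]_(x in SG) f x = \sum_(w <- s) M w * (3 ^+ size w)^-1.
Proof.
have mS := measurable_gasket.
elim: s => [|w s [IH1 IH2]] /=.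
  split; last by rewrite big_nil; under eq_Rintegral do rewrite big_nil; rewrite Rintegral_cst ?mul0r.
  under [X in _.-integrable _ X]eq_fun do rewrite /= big_nil.
  exact: integrable0.
have [iw Iw] := gasket_indicator_integral w.
have iMw : mu.-integrable SG (EFin \o (fun x => M w * \1_(ifs_word q w @` SG) x)).
  under [X in _.-integrable _ X]eq_fun do rewrite /= EFinM.
  exact: integrableZl.
split.
  under [X in _.-integrable _ X]eq_fun do rewrite /= big_cons EFinD.
  exact: integrableD.
under eq_Rintegral do rewrite big_cons.
by rewrite RintegralD // RintegralZl // Iw IH2 big_cons.
Qed.

(** The bridge from pointwise to integral bounds: error terms on cells are weighted by the cell
    masses 3^-|w|. Weights may be negative and cells may overlap. *)
Lemma gasket_integral_le f g (s : seq (seq 'I_3)) (M : seq 'I_3 -> R) :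
  {within SG, continuous f} -> {within SG, continuous g} ->
  (forall x, SG x -> f x <= g x + \sum_(w <- s) M w * \1_(ifs_word q w @` SG) x) ->
  \int[mu]_(x in SG) f x <= \int[mu]_(x in SG) g x + \sum_(w <- s) M w * (3 ^+ size w)^-1.
Proof.
move=> cf cg fg; have mS := measurable_gasket.
have [is_ <-] := gasket_cells_integral s M.
rewrite -RintegralD //; last exact: gasket_integrable.
apply: le_Rintegral => //; first exact: gasket_integrable.
under [X in _.-integrable _ X]eq_fun do rewrite /= EFinD.
by apply: integrableD => //; exact: gasket_integrable.
Qed.

(** If u(x) is nonzero, continuity keeps |u| at least |u(x)|/2 on a small cell around [x], and that
    cell has positive mass. *)
Lemma gasket_inner_eq0 u : {within SG, continuous u} -> gasket_inner u u = 0 ->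
  forall x, SG x -> u x = 0.
Proof.
move=> cu Iu x Sx; apply/eqP; apply: contra_eqT Iu => ux.
have e0 : 0 < `|u x| / 2 by rewrite divr_gt0 // normr_gt0.
have [d d0 hd] := within_continuous_dist cu Sx e0.
have [M M0 hM] := gasket_bounded hSG.
have [n hn] := geometric_lt M d0.
have [w [y [hw Sy xy]]] := gasket_words hSG n Sx.
move: hw; rewrite mem_words => /eqP sw.
rewrite gt_eqF // /gasket_inner.
(* A negative weight on the single cell [w] yields a lower bound for the integral of u^2. *)
have := @gasket_integral_le (0 : plane -> R) (fun x => u x * u x) [:: w] (fun=> - (`|u x| / 2) ^+ 2).
rewrite big_seq1 {1}/Rintegral integral0 /= => h.
have c0 : {within SG, continuous (0 : plane -> R)} by exact: within_continuous0.
have {}h := h c0 (within_continuousM cu cu).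
suff : 0 < (`|u x| / 2) ^+ 2 * (3 ^+ size w)^-1 :> R /\
    forall z : plane, SG z -> 0 <= u z * u z + \sum_(v <- [:: w]) - (`|u x| / 2) ^+ 2 * \1_(ifs_word q v @` SG) z.
  by move=> [pos /h]; rewrite mulNr; lra.
split; first by rewrite mulr_gt0 ?exprn_gt0 // invr_gt0 exprn_gt0.
move=> z Sz; rewrite big_seq1 indicE; case: (boolP (z \in _)) => [|_]; last first.
  by rewrite mulr0 addr0 -expr2 sqr_ge0.
rewrite inE => -[y' Sy' zy']; rewrite mulr1 subr_ge0 -expr2.
have : `|x - z| < d.
  rewrite xy -zy' norm_ifs_wordB sw; apply: le_lt_trans hn.
  by apply: ler_wpM2l; [rewrite exprn_ge0 | exact: hM].
move=> /(hd z Sz) uz; rewrite -[leRHS]real_normK ?num_real //.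
rewrite lerXn2r ?nnegrE // ?divr_ge0 //.
have := ler_normD (u x - u z) (u z); rewrite subrK; lra.
Qed.

(* The vertices [F_{w|n} q_0] of the cells around [x] form a chain from [q_0] to [x];
   consecutive ones lie in a common cell of level [n+1], so that they contribute at
   most [(3/5)^((n+1)/2) sqrt M <= (4/5)^(n+1) sqrt M]. *)
Lemma gasket_oscillation_chain u M n x : SG x -> (forall m, level_form q m u u <= M) ->
  exists w y, [/\ size w = n, SG y, x = ifs_word q w y &
   `|u (ifs_word q w (q 0)) - u (q 0)| <= 4 * (1 - (4 / 5) ^+ n) * Num.sqrt M].
Proof.
move=> Sx hM; elim: n => [|n [w [y [sw Sy xy IH]]]].
  by exists [::], x; split=> //=; rewrite subrr normr0 expr0 subrr mulr0 mul0r.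
have [i [z [Sz yz]]] := gasket_preimage hSG Sy.
exists (rcons w i), z; split=> //; first by rewrite size_rcons sw.
  by rewrite ifs_word_rcons -yz.
have M0 : 0 <= M by apply: le_trans (hM 0%N); exact: level_form_ge0.
(* Since F_i q_0 = F_0 q_i and F_0 q_0 = q_0, the consecutive vertices F_w F_i q_0 and F_w q_0 both
   lie in the cell [rcons w 0]. *)
have edge : `|u (ifs_word q (rcons w 0) (q i)) - u (ifs_word q (rcons w 0) (q 0))|
    <= (4 / 5) ^+ n.+1 * Num.sqrt M.
  have -> : (4 / 5) ^+ n.+1 * Num.sqrt M = Num.sqrt (((4 / 5) ^+ n.+1) ^+ 2 * M).
    by rewrite sqrtrM ?sqr_ge0 // sqrtr_sqr ger0_norm ?exprn_ge0.
  rewrite -sqrtr_sqr; apply: ler_wsqrtr; set v := u \o ifs_word q (rcons w 0).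
  have hv : (v (q i) - v (q 0)) ^+ 2 <= cell_form q v v.
    rewrite /cell_form -!expr2.
    have := sqr_ge0 (v (q 0) - v (q 1)); have := sqr_ge0 (v (q 0) - v (q 2)).
    have := sqr_ge0 (v (q 1) - v (q 2)).
    by elim/I3P: i {yz} => *; rewrite ?subrr; rewrite -1?[(_ - v (q 0)) ^+ 2]sqrrN ?opprB; lra.
  apply: le_trans hv _; rewrite -exprM mulnC exprM.
  have p0 : 0 < (5 / 3 : R) ^+ n.+1 by rewrite exprn_gt0 // divr_gt0.
  have : (5 / 3) ^+ n.+1 * cell_form q v v <= M.
    apply: le_trans (hM n.+1); apply: ler_wpM2l; first exact: ltW.
    have wm : rcons w 0 \in words n.+1 by rewrite mem_words size_rcons sw.
    rewrite (bigD1_seq _ wm) ?uniq_words //= lerDl.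
    by apply: sumr_ge0 => w' _; exact: cell_form_ge0.
  rewrite mulrC -ler_pdivlMr // => /le_trans; apply.
  (* This rests on 3/5 <= (4/5)^2. *)
  rewrite mulrC; apply: ler_wpM2r => //; rewrite -exprVn; apply: lerXn2r; rewrite ?nnegrE; lra.
rewrite !ifs_word_rcons (ifs_vertexC q 0 i) (ifs_vertex q 0) in edge.
rewrite ifs_word_rcons; have := ler_normD (u (ifs_word q w (ifs q i (q 0))) - u (ifs_word q w (q 0)))
  (u (ifs_word q w (q 0)) - u (q 0)).
rewrite addrA subrK => /le_trans; apply; apply: le_trans (lerD edge IH) _.
(* The geometric sum advances: 4(1 - r) + 4r/5 = 4(1 - 4r/5) for r = (4/5)^n. *)
by rewrite exprS le_eqVlt; apply/orP; left; apply/eqP; field.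
Qed.

(** The chain bound is at most 4 sqrt(M) at every level, and the end points F_w q_0 of the chains
    converge to [x]; squaring gives the constant 16. *)
Lemma gasket_oscillation u x : {within SG, continuous u} -> bounded_energy q u -> SG x ->
  (u x - u (q 0)) ^+ 2 <= 16 * limit_energy q u.
Proof.
move=> cu bu Sx; set M := limit_energy q u.
have hM m : level_form q m u u <= M by exact: level_form_le.
have M0 : 0 <= M by exact: limit_energy_ge0.
have h : `|u x - u (q 0)| <= 4 * Num.sqrt M.
  apply/ler_addgt0Pr => e e0.
  have [d d0 hd] := within_continuous_dist cu Sx e0.
  have [D D0 hD] := gasket_bounded hSG.
  have [n hn] := geometric_lt D d0.
  have [w [y [sw Sy xy hw]]] := gasket_oscillation_chain n Sx hM.
  have Sq : SG (q 0) by exact: (gasket_vertex hSG).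
  have : `|x - ifs_word q w (q 0)| < d.
    rewrite {1}xy norm_ifs_wordB sw; apply: le_lt_trans hn.
    by apply: ler_wpM2l; [rewrite exprn_ge0 | exact: hD].
  move=> /(hd _ (gasket_ifs_word hSG w Sq)) ux.
  have := ler_normD (u x - u (ifs_word q w (q 0))) (u (ifs_word q w (q 0)) - u (q 0)).
  rewrite addrA subrK => /le_trans; apply; rewrite addrC; apply: lerD; last exact: ltW.
  apply: le_trans hw _; apply: ler_wpM2r; first exact: sqrtr_ge0.
  have : 0 <= (4 / 5 : R) ^+ n by rewrite exprn_ge0.
  lra.
have -> : 16 * M = (4 * Num.sqrt M) ^+ 2 by rewrite exprMn sqr_sqrtr //; ring.
rewrite -[leLHS]real_normK ?num_real //; by apply: lerXn2r; rewrite ?nnegrE // mulr_ge0 ?sqrtr_ge0.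
Qed.

Lemma gasket_cell_oscillation u w x : {within SG, continuous u} -> bounded_energy q u ->
  SG x -> (u (ifs_word q w x) - u (ifs_word q w (q 0))) ^+ 2 <=
    16 * limit_energy q (u \o ifs_word q w).
Proof.
move=> cu bu Sx; apply: (@gasket_oscillation (u \o ifs_word q w)) => //.
  exact: within_continuous_ifs_word.
exact: bounded_energy_ifs_word.
Qed.

End GasketMeasure.

(** * The Dirichlet forms *)

(** Compactness of the interval gives a cluster point, and an ultrafilter converges to its cluster
    points. *)
Lemma ultra_cvg_bounded {R : realType} (T : Type) (G : set_system T) (f : T -> R) (M : R) :
  UltraFilter G -> (forall n, `|f n| <= M) -> exists l : R, f @ G --> l.
Proof.
move=> UG fM.
have cI : compact `[- M, M] by exact: segment_compact.
have PG : ProperFilter G by exact: ultra_proper.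
have fI : G (f @^-1` `[- M, M]).
  by apply: filterE => n; rewrite /= in_itv /= -ler_norml.
have [l [_ cl]] := cI (f @ G) _ fI; exists l => W /= Wl.
have [//|GC] := in_ultra_setVsetC (f @^-1` W) UG.
have [y []] := cl (~` W) W GC Wl.
by [].
Qed.

(** The restriction e <= 1 lets [C] absorb bounds on a limit that are valid only for errors at most
    1. *)
Lemma small_eq0 {R : realType} (a C : R) : (forall e, 0 < e -> e <= 1 -> `|a| <= e * C) -> a = 0.
Proof.
move=> h; apply/eqP; rewrite -normr_le0; apply/ler_addgt0Pr => d d0; rewrite add0r.
have C0 : 0 <= C by have := h 1 ltr01 (lexx 1); rewrite mul1r; apply: le_trans.
pose e := Num.min 1 (d / (C + 1)).
have e0 : 0 < e by rewrite lt_min ltr01 divr_gt0 //; lra.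
apply: le_trans (h e e0 _) _; first by rewrite ge_min lexx.
apply: le_trans (_ : d / (C + 1) * C <= d).
  by apply: ler_wpM2r => //; rewrite ge_min lexx orbT.
rewrite -mulrA ger_pMr // mulrC ler_pdivrMr; lra.
Qed.

Section DirichletForm.
Context {R : realType}.
Local Notation plane := (R * R)%type.
Variables (q : 'I_3 -> plane) (SG : set plane) (mu : probability plane R) (B : set plane).
Hypotheses (hq : equilateral q) (hSG : is_gasket q SG) (hmu : is_gasket_measure q SG mu).
(** Vanishing at [q 0] turns the oscillation estimate into a sup-norm bound by the energy. *)
Hypothesis Bq0 : B (q 0).
Implicit Types u v : plane -> R.

Local Notation D := (dirichlet_domain q SG B).
Local Notation EE := (energy_form q).
Local Notation II := (gasket_inner SG mu).

Lemma dirichletP u : D u <->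
  [/\ {within SG, continuous u}, bounded_energy q u & forall x, B x -> u x = 0].
Proof.
split=> [[[cu eu] Bu]|[cu eu Bu]]; first by split=> //; apply/bounded_energyP.
by split=> //; split=> //; apply/bounded_energyP.
Qed.

Lemma dirichlet_continuous u : D u -> {within SG, continuous u}.
Proof. by case/dirichletP. Qed.

Lemma dirichlet_bounded_energy u : D u -> bounded_energy q u.
Proof. by case/dirichletP. Qed.

Lemma dirichlet_subspace : subspace_set (D : set (plane -> R)).
Proof.
split=> [|a u v /dirichletP[cu bu Bu] /dirichletP[cv bv Bv]]; apply/dirichletP; split=> //.
- exact: within_continuous0.
- exact: bounded_energy0.
- exact: within_continuousD (within_continuousZ cu) cv.
- by apply: bounded_energyD => //; exact: bounded_energyZ.
- by move=> x Bx; rewrite !fctE Bu // Bv // addr0; exact: mulr0.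
Qed.

Lemma energy_psd : psd_form D EE.
Proof.
split=> [u v|a u v w|u].
- by move=> /dirichlet_bounded_energy bu /dirichlet_bounded_energy bv; exact: energy_formC.
- move=> /dirichlet_bounded_energy bu /dirichlet_bounded_energy bv /dirichlet_bounded_energy bw.
  exact: energy_formP.
- by move=> /dirichlet_bounded_energy bu; rewrite energy_form_sqr // limit_energy_ge0.
Qed.

Lemma inner_psd : psd_form D II.
Proof.
split=> [u v _ _|a u v w|u _]; [exact: gasket_innerC| |exact: gasket_inner_ge0].
move=> /dirichlet_continuous cu /dirichlet_continuous cv /dirichlet_continuous cw.
exact: (gasket_innerP mu hSG a cu cv cw).
Qed.

(** The gasket itself, as the cell of the empty word, has mass 1, so pointwise bounds carry over to
    the integral. *)
Lemma inner_le u v a b : {within SG, continuous u} -> {within SG, continuous v} ->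
  (forall x, SG x -> `|u x| <= a) -> (forall x, SG x -> `|v x| <= b) -> `|II u v| <= a * b.
Proof.
move=> cu cv ua vb.
have c0 : {within SG, continuous (0 : plane -> R)} by exact: within_continuous0.
have key f : {within SG, continuous f} -> (forall x, SG x -> f x <= a * b) ->
    \int[mu]_(x in SG) f x <= a * b.
  move=> cf fab; have := @gasket_integral_le _ _ _ _ hSG hmu f (0 : plane -> R) [:: [::]] (fun=> a * b).
  rewrite {2}/Rintegral integral0 big_seq1 /= expr0 invr1 mulr1 add0r; apply=> // x Sx.
  rewrite big_seq1 add0r indicE mem_set ?mulr1; first exact: fab.
  by exists x.
have uv x : SG x -> `|u x * v x| <= a * b.
  by move=> Sx; rewrite normrM ler_pM // ?ua ?vb.
rewrite ler_norml; apply/andP; split; last first.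
  apply: key; first exact: within_continuousM.
  by move=> x /uv; apply: le_trans; exact: ler_norm.
rewrite lerNl -[- _]mulN1r -RintegralZl; [|exact: (measurable_gasket hSG)|]; last first.
  by apply: (gasket_integrable mu hSG); exact: within_continuousM.
apply: key; first exact: (within_continuousZ (within_continuousM cu cv)).
by move=> x /uv; apply: le_trans; rewrite mulN1r -normrN; exact: ler_norm.
Qed.

Lemma cell_energy_le u k w : bounded_energy q u -> w \in words k ->
  limit_energy q (u \o ifs_word q w) <= (3 / 5) ^+ k * limit_energy q u.
Proof.
move=> bu wk; rewrite (limit_energy_cat hq k bu) mulrA -exprMn.
have -> : 3 / 5 * (5 / 3) = 1 :> R by field.
rewrite expr1n mul1r (bigD1_seq w) ?uniq_words //= lerDl.
by apply: sumr_ge0 => v _; exact: limit_energy_ge0.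
Qed.

(** Equicontinuity on an energy ball: the energy of [u] on a cell of level k is at most (3/5)^k |K|,
    so the level depends only on [K] and [e]. *)
Lemma cell_oscillation_uniform K e : 0 < e -> exists k, forall u w x,
  {within SG, continuous u} -> bounded_energy q u -> limit_energy q u <= K ->
  w \in words k -> SG x ->
  `|u (ifs_word q w x) - u (ifs_word q w (q 0))| < e.
Proof.
move=> e0.
have [k hk] : exists k : nat, (3 / 5) ^+ k * (16 * `|K|) < e ^+ 2.
  have : (fun n => (16 * `|K|) * (3 / 5) ^+ n) @ \oo --> (0 : R).
    by apply: cvg_geometric; rewrite ger0_norm; lra.
  have e20 : 0 < e ^+ 2 by rewrite exprn_gt0.
  move=> /cvgrPdist_lt/(_ _ e20)[n _ hn]; exists n.
  have := hn n (leqnn n); rewrite sub0r normrN mulrC; apply: le_lt_trans.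
  exact: ler_norm.
exists k => u w x cu bu uK wk Sx.
rewrite -(@ltr_pXn2r _ 2) ?nnegrE // ?ltW // real_normK ?num_real //.
apply: le_lt_trans hk; apply: le_trans (gasket_cell_oscillation hq hSG w cu bu Sx) _.
rewrite mulrCA; apply: ler_wpM2l => //; apply: le_trans (cell_energy_le bu wk) _.
by apply: ler_wpM2l; [rewrite exprn_ge0 | apply: le_trans uK _; exact: ler_norm].
Qed.

Lemma dirichlet_sup_le u x : D u -> SG x -> `|u x| <= 4 * Num.sqrt (limit_energy q u).
Proof.
move=> /dirichletP[cu bu Bu] Sx.
have := gasket_oscillation hq hSG cu bu Sx; rewrite (Bu _ Bq0) subr0 => h.
rewrite -(@ler_pXn2r _ 2) ?nnegrE ?mulr_ge0 ?sqrtr_ge0 // real_normK ?num_real //.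
by rewrite exprMn sqr_sqrtr ?limit_energy_ge0 //; apply: le_trans h _; lra.
Qed.

(** * Compactness of minimizing sequences *)

Section Compactness.
Variables (u : nat -> plane -> R) (l : R).
Hypotheses (Du : forall n, D (u n)) (Eu : forall n, EE (u n) (u n) <= l + n.+1%:R^-1).

Let K := l + 1.

Let Ku n : limit_energy q (u n) <= K.
Proof.
rewrite -energy_form_sqr //; last exact: dirichlet_bounded_energy.
by apply: le_trans (Eu n) _; rewrite lerD2l invf_le1 // ler1n.
Qed.

(** An ultrafilter gives limits at all points at once. They are uniform because convergence is
    controlled at finitely many cell vertices, and the oscillation on the cells is uniformly
    small. *)
Lemma ultra_uniform_limit : exists G : set_system nat, exists g : plane -> R,
  [/\ UltraFilter G, \oo `<=` G,
   forall x, SG x -> (fun n => u n x) @ G --> g x,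
   forall x, B x -> g x = 0
  & forall e, 0 < e -> G [set n | forall x, SG x -> `|u n x - g x| <= e]].
Proof.
have [G [UG ooG]] := @ultraFilterLemma nat \oo _.
have FG : ProperFilter G by exact: ultra_proper.
have h x : SG x -> exists y : R, (fun n => u n x) @ G --> y.
  move=> Sx; apply: (@ultra_cvg_bounded _ _ _ _ (4 * Num.sqrt K)) => // n.
  apply: le_trans (dirichlet_sup_le (Du n) Sx) _.
  by apply: ler_wpM2l => //; apply: ler_wsqrtr.
(* The value 0 off [SG] secures the boundary condition at points of [B] outside [SG] too. *)
pose g x := if `[< SG x >] then lim ((fun n => u n x) @ G) else 0.
have hg x : SG x -> (fun n => u n x) @ G --> g x.
  move=> Sx; rewrite /g asboolT //; have [y hy] := h x Sx.
  by rewrite (cvg_lim _ hy).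
exists G, g; split=> //.
  move=> x Bx; rewrite /g; case: asboolP => // Sx.
  have -> : (fun n => u n x) = fun=> 0.
    by apply/funext => n; case/dirichletP: (Du n) => _ _; apply.
  exact: lim_cst.
move=> e e0; have e50 : 0 < e / 5 by rewrite divr_gt0.
have [k hk] := cell_oscillation_uniform K e50.
have Sv w : SG (ifs_word q w (q 0)).
  by apply: gasket_ifs_word => //; exact: (gasket_vertex hSG).
pose Q n w := `|g (ifs_word q w (q 0)) - u n (ifs_word q w (q 0))| < e / 5.
have GQ (s : seq (seq 'I_3)) : G [set n | forall w, w \in s -> Q n w].
  elim: s => [|w s IH]; first by apply: filterE.
  have := hg _ (Sv w) => /cvgrPdist_lt/(_ _ e50) Gw.
  apply: filterS (filterI Gw IH) => n [/= n1 n2] w'.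
  by rewrite inE => /orP[/eqP->//|/n2].
apply: filterS (GQ (words k)) => n Qn x Sx.
have [w [y [wk Sy xy]]] := gasket_words hSG k Sx.
have := hg _ Sx => /cvgrPdist_lt/(_ _ e50) Gx.
(* An index [m] depending on [x] links g(x) to g(F_w q_0). The five errors are the oscillations of
   [u n] and [u m] on the cell, the distances of both to [g] at F_w q_0, and the distance of u_m(x)
   to g(x). *)
have [m [/= Qm mx]] := filter_ex (filterI (GQ (words k)) Gx).
have osc p : `|u p x - u p (ifs_word q w (q 0))| < e / 5.
  rewrite {1}xy; apply: hk => //; [exact: dirichlet_continuous|exact: dirichlet_bounded_energy].
move: (Qn w wk) (Qm w wk) (osc n) (osc m) mx; rewrite /Q !ltr_norml ler_norml => *.
by apply/andP; split; lra.
Qed.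

(** Uniform limits preserve continuity and inner products. Each level form involves finitely many
    points, so it passes to the limit and the energy bound survives. *)
Lemma dirichlet_compact : (forall n, II (u n) (u n) = 1) ->
  exists g, [/\ D g, EE g g <= l, II g g = 1 &
    forall v, D v -> (forall n, II (u n) v = 0) -> II g v = 0].
Proof.
move=> Iu; have [G [g [UG ooG hg Bg unif]]] := ultra_uniform_limit.
have FG : ProperFilter G by exact: ultra_proper.
have cg : {within SG, continuous g}.
  apply: within_continuousP => x e Sx e0; have e30 : 0 < e / 3 by rewrite divr_gt0.
  have [n hn] := filter_ex (unif _ e30).
  have [d d0 hd] := within_continuous_dist (dirichlet_continuous (Du n)) Sx e30.
  exists d => // y Sy xy; move: (hn _ Sx) (hn _ Sy) (hd _ Sy xy).
  rewrite !ler_norml !ltr_norml => *; by apply/andP; split; lra.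
have lg m : level_form q m g g <= l.
  have Sv w i : SG (ifs_word q w (q i)).
    by apply: gasket_ifs_word => //; exact: (gasket_vertex hSG).
  have cvgL : (fun n => level_form q m (u n) (u n)) @ G --> level_form q m g g.
    apply: cvgM; first exact: cvg_cst.
    apply: cvg_sum_seq => w /=.
    have cB i j : (fun n => u n (ifs_word q w (q i)) - u n (ifs_word q w (q j))) @ G -->
       g (ifs_word q w (q i)) - g (ifs_word q w (q j)).
      by apply: cvgB; apply: hg.
    by apply: cvgD; [|apply: cvgD]; apply: cvgM; exact: cB.
  apply/ler_addgt0Pr => e e0; rewrite -(cvg_lim _ cvgL) //; apply: limr_le.
    by apply/cvg_ex; eexists; exact: cvgL.
  apply: ooG; have := near_infty_natSinv_lt (PosNum e0); apply: filterS => n /= hn.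
  apply: le_trans (level_form_le hq m (dirichlet_bounded_energy (Du n))) _.
  rewrite -energy_form_sqr //; last exact: dirichlet_bounded_energy.
  by apply: le_trans (Eu n) _; rewrite lerD2l ltW.
have bg : bounded_energy q g by exists l.
have Dg : D g by apply/dirichletP.
have innerB n v : D v -> II g v - II (u n) v = II (g - u n) v.
  move=> Dv; rewrite -[- u n]scaleN1r (formDl inner_psd) //; last first.
    exact: (subspaceZ dirichlet_subspace).
  by rewrite (formZl dirichlet_subspace inner_psd) // mulN1r.
have cB n : {within SG, continuous (g - u n)}.
  by apply: dirichlet_continuous; apply: (subspaceB dirichlet_subspace).
have gB n e : (forall x, SG x -> `|u n x - g x| <= e) ->
    forall x, SG x -> `|(g - u n) x| <= e.
  by move=> h x Sx; rewrite !fctE distrC; exact: h.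
exists g; split=> //.
- by rewrite energy_form_sqr //; exact: limit_energy_le.
- pose b := 4 * Num.sqrt K.
  have ub n x : SG x -> `|u n x| <= b.
    move=> Sx; apply: le_trans (dirichlet_sup_le (Du n) Sx) _.
    by apply: ler_wpM2l => //; apply: ler_wsqrtr.
  apply/eqP; rewrite -subr_eq0; apply/eqP; apply: (@small_eq0 _ _ (2 * b + 1)) => e e0 e1.
  have [n hn] := filter_ex (unif _ e0).
  have gb x : SG x -> `|g x| <= b + 1.
    move=> Sx; have := ub n x Sx; have := hn x Sx.
    by rewrite !ler_norml => *; apply/andP; split; lra.
  rewrite -[X in _ - X](Iu n); have -> : II g g - II (u n) (u n) = II (g - u n) g + II (g - u n) (u n).
    rewrite -!innerB // [II (u n) g]gasket_innerC; ring.
  apply: le_trans (ler_normD _ _) _.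
  have h1 := inner_le (cB n) cg (gB _ _ hn) gb.
  have h2 := inner_le (cB n) (dirichlet_continuous (Du n)) (gB _ _ hn) (ub n).
  apply: le_trans (lerD h1 h2) _.
  by rewrite -mulrDr (_ : b + 1 + b = 2 * b + 1) //; ring.
move=> v Dv Iv.
have [c hc] : exists c, forall x, SG x -> `|v x| <= c.
  by exists (4 * Num.sqrt (limit_energy q v)) => x Sx; exact: dirichlet_sup_le.
apply: (@small_eq0 _ _ c) => e e0 e1; have [n hn] := filter_ex (unif _ e0).
rewrite -[II g v]subr0 -(Iv n) innerB //.
exact: inner_le (cB n) (dirichlet_continuous Dv) (gB _ _ hn) hc.
Qed.

End Compactness.

(** [T] is [u] with the cells in [P] replaced by 0, which saves their energy (5/3)^k S. On each of
    them u^2 <= 16 E(u o F_w), because [u] vanishes at F_w q_0; with cell mass 3^-k the squared norm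
    drops by at most 16 S/3^k. *)
Lemma cutoff_energy (P : pred (seq 'I_3)) k u T : D u -> {within SG, continuous T} ->
  (forall w y, w \in words k -> ~~ P w -> SG y -> T (ifs_word q w y) = u (ifs_word q w y)) ->
  (forall w y, w \in words k -> P w -> SG y -> T (ifs_word q w y) = 0) ->
  (forall w, w \in words k -> P w -> u (ifs_word q w (q 0)) = 0) ->
  let S := \sum_(w <- words k | P w) limit_energy q (u \o ifs_word q w) in
  [/\ bounded_energy q T, limit_energy q T + (5 / 3) ^+ k * S <= limit_energy q u &
    II u u <= II T T + 16 / 3 ^+ k * S].
Proof.
move=> Du cT TnP TP uP S; have [cu bu Bu] := (dirichletP u).1 Du.
have Sv w i : SG (ifs_word q w (q i)).
  by apply: gasket_ifs_word => //; exact: (gasket_vertex hSG).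
have p0 : 0 < (5 / 3 : R) ^+ k by rewrite exprn_gt0 // divr_gt0.
pose S' := \sum_(w <- words k | ~~ P w) limit_energy q (u \o ifs_word q w).
have eu : limit_energy q u = (5 / 3) ^+ k * S' + (5 / 3) ^+ k * S.
  by rewrite (limit_energy_cat hq k bu) (bigID P) /= -mulrDr addrC.
(* Passing to level k + m can only increase the form and splits it over the words of length k: cells
   in [P] contribute nothing, and on the others [T] agrees with [u]. *)
have lT m : level_form q m T T <= (5 / 3) ^+ k * S'.
  apply: le_trans (level_form_nondecreasing q T (leq_addl k m)) _.
  rewrite level_form_cat; apply: ler_wpM2l; first exact: ltW.
  rewrite (bigID P) /= [X in X + _]big1_seq ?add0r => [|w /andP[Pw wk]].
    rewrite big_seq_cond [leRHS]big_seq_cond; apply: ler_sum => w /andP[wk Pw].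
    have -> : level_form q m (T \o ifs_word q w) (T \o ifs_word q w) =
              level_form q m (u \o ifs_word q w) (u \o ifs_word q w).
      congr (_ * _); apply: eq_bigr => v _.
      by rewrite /cell_form /= !(TnP w) //; exact: Sv.
    apply: level_form_le => //; exact: bounded_energy_ifs_word.
  rewrite /level_form big1 ?mulr0 // => v _.
  by rewrite /cell_form /= !(TP w) ?subrr ?mul0r ?addr0 //; exact: Sv.
split; first by exists ((5 / 3) ^+ k * S').
  by rewrite eu lerD2r; exact: limit_energy_le.
pose M w := if P w then 16 * limit_energy q (u \o ifs_word q w) else 0.
have M0 w : 0 <= M w by rewrite /M; case: (P w); rewrite ?mulr_ge0 ?limit_energy_ge0.
have -> : 16 / 3 ^+ k * S = \sum_(w <- words k) M w * (3 ^+ size w)^-1.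
  rewrite /S big_mkcond mulr_sumr; apply: eq_big_seq => w; rewrite mem_words => /eqP ->.
  by rewrite /M; case: (P w); rewrite ?mulr0 ?mul0r // mulrAC.
apply: (@gasket_integral_le _ _ _ _ hSG hmu); [exact: within_continuousM|exact: within_continuousM|].
move=> x Sx; have [w [y [wk Sy xy]]] := gasket_words hSG k Sx.
have M1 s : 0 <= M s * \1_(ifs_word q s @` SG) x by rewrite mulr_ge0.
have [Pw|nPw] := boolP (P w); last first.
  by rewrite xy (TnP w) // lerDl; apply: sumr_ge0 => v _; rewrite -xy.
rewrite (bigD1_seq w) ?uniq_words //= indicE mem_set; last by exists y.
rewrite mulr1 /M Pw -/M.
have := gasket_cell_oscillation hq hSG w cu bu Sy; rewrite uP // subr0 -xy expr2 => h.
have : 0 <= T x * T x by rewrite -expr2 sqr_ge0.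
have : 0 <= \sum_(s <- words k | s != w) M s * \1_(ifs_word q s @` SG) x by apply: sumr_ge0.
move=> h1 h2; apply: le_trans h _; rewrite addrCA lerDl addr_ge0 //.
Qed.

(** By 16 x < 5^k, [x] times the squared norm lost is dominated by the energy saved. Strictness
    forces S = 0 when [T] is null, and then [u] is null. *)
Lemma cutoff_rayleigh (P : pred (seq 'I_3)) k x u T : 0 <= x -> 16 * x < 5 ^+ k ->
  D u -> {within SG, continuous T} ->
  (forall w y, w \in words k -> ~~ P w -> SG y -> T (ifs_word q w y) = u (ifs_word q w y)) ->
  (forall w y, w \in words k -> P w -> SG y -> T (ifs_word q w y) = 0) ->
  (forall w, w \in words k -> P w -> u (ifs_word q w (q 0)) = 0) ->
  EE u u <= x * II u u ->
  [/\ bounded_energy q T, EE T T <= x * II T T & II T T = 0 -> II u u = 0].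
Proof.
move=> x0 xk Du cT TnP TP uP; have bu := dirichlet_bounded_energy Du.
have [bT] := cutoff_energy Du cT TnP TP uP.
set S := \sum_(w <- _ | _) _ => hE hI; rewrite !energy_form_sqr // => Eu.
have S0 : 0 <= S by apply: sumr_ge0 => w _; exact: limit_energy_ge0.
have ET := limit_energy_ge0 hq T.
have t0 : 0 < 3 ^+ k :> R by rewrite exprn_gt0.
have gap : x * (16 / 3 ^+ k) < (5 / 3) ^+ k.
  by rewrite expr_div_n mulrA ltr_pM2r ?invr_gt0 // mulrC.
have xI := ler_wpM2l x0 hI; rewrite mulrDr mulrA in xI.
have gapS : x * (16 / 3 ^+ k) * S <= (5 / 3) ^+ k * S by apply: ler_wpM2r => //; exact: ltW.
split=> // [|IT]; first by lra.
rewrite IT mulr0 add0r in xI; rewrite IT add0r in hI.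
have S00 : S = 0.
  apply/eqP; rewrite eq_le S0 andbT -(@pmulr_rle0 _ ((5 / 3) ^+ k - x * (16 / 3 ^+ k))) ?subr_gt0 //.
  by rewrite mulrBl; lra.
apply/eqP; rewrite eq_le gasket_inner_ge0 andbT.
by rewrite S00 mulr0 in hI.
Qed.

End DirichletForm.

(** * Comparison of the counting functions *)

Section Counting.
Context {R : realType}.
Local Notation plane := (R * R)%type.
Variables (q : 'I_3 -> plane) (SG : set plane) (mu : probability plane R) (B : set plane).
Hypotheses (hq : equilateral q) (hSG : is_gasket q SG) (hmu : is_gasket_measure q SG mu).
Hypothesis Bq0 : B (q 0).

Local Notation D := (dirichlet_domain q SG B : set (plane -> R)).
Local Notation EE := (energy_form q).
Local Notation II := (gasket_inner SG mu).

Lemma lincombE n (c : 'I_n -> R) (e : 'I_n -> plane -> R) x :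
  lincomb c e x = \sum_(i < n) c i * e i x.
Proof. by rewrite /lincomb fct_sumE. Qed.

Lemma free_onP n (e : 'I_n -> plane -> R) : (forall i, D (e i)) ->
  free_on SG e <-> free_for II e.
Proof.
move=> De.
have DL c : D (lincomb c e) by exact: (subspace_lincomb (dirichlet_subspace _ _ hq)).
split=> fe c h i; apply: fe.
  move=> x Sx; rewrite -lincombE.
  exact: (gasket_inner_eq0 hSG hmu (dirichlet_continuous hq (DL c)) h).
rewrite /gasket_inner /Rintegral.
rewrite (eq_integral (cst 0%E)) ?integral0 // => x; rewrite inE => Sx.
by rewrite lincombE h // mulr0.
Qed.

Lemma multiplicityE lam :
  multiplicity q SG mu B lam = eigenmultiplicity D EE II lam.
Proof.
congr ereal_sup; apply/seteqP; split=> _ [n [e [he fe]] <-]; exists n => //; exists e.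
  by split=> //; apply/free_onP => // i; case: (he i).
by split=> //; apply/free_onP => // i; case: (he i).
Qed.

Lemma counting_functionE x : counting_function q SG mu B x = eigencount D EE II x.
Proof.
rewrite /counting_function /eigencount.
have -> : [set lam | Defs.eigenvalue q SG mu B lam /\ lam <= x] =
  [set lam | (exists2 u, eigenvector D EE II lam u & II u u <> 0) /\ lam <= x].
  apply/seteqP; split=> lam [[u eu hu] lx]; split=> //; exists u => //.
    have [Du _] := eu; case: hu => y Sy uy Iu; apply: uy.
    exact: (gasket_inner_eq0 hSG hmu (dirichlet_continuous hq Du) Iu).
  apply: contrapT => h; apply: hu; rewrite /gasket_inner /Rintegral.
  rewrite (eq_integral (cst 0%E)) ?integral0 // => y; rewrite inE => Sy.
  have -> : u y = 0 by apply: contrapT => uy; apply: h; exists y.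
  by rewrite mulr0.
by apply: eq_esum => lam _; exact: multiplicityE.
Qed.

(** Vanishing at the points indexed by [s] is a system of |s| linear equations in the coefficients;
    the rows of [K] are a basis of its solutions. *)
Lemma vanishing_subspace n (e : 'I_n -> plane -> R) (s : seq (seq 'I_3)) :
  exists r (K : 'M[R]_(r, n)), [/\ (n <= r + size s)%N, row_free K &
    forall (c : 'rV[R]_r) w, w \in s -> lincomb ((c *m K) 0) e (ifs_word q w (q 0)) = 0].
Proof.
pose A : 'M[R]_(n, size s) := \matrix_(i, j) e i (ifs_word q (nth [::] s j) (q 0)).
exists (\rank (kermx A)), (row_base (kermx A)); split.
- by rewrite mxrank_ker addnC -leq_subLR leq_sub2l // rank_leq_col.
- exact: row_base_free.
move=> c w ws; have sw : (index w s < size s)%N by rewrite index_mem.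
have : (c *m row_base (kermx A)) *m A = 0.
  apply/sub_kermxP; apply: submx_trans (submxMl _ _) _.
  by rewrite eq_row_base.
move=> /rowP/(_ (Ordinal sw)); rewrite [RHS]mxE mxE => h; rewrite lincombE -[RHS]h.
by apply: eq_bigr => i _; rewrite [A i _]mxE /= nth_index.
Qed.

(** Here all cells of level k are cut off, so T = 0: a combination vanishing at all 3^k points F_w
    q_0 is null, and the conditions leave no nonzero combination. *)
Lemma admissible_bounded x k n : 0 <= x -> 16 * x < 5 ^+ k ->
  admissible D EE II x n -> (n <= 3 ^ k)%N.
Proof.
move=> x0 xk [e [De fe Ee]].
have [r [K [nr Kfree van]]] := vanishing_subspace e (words k).
rewrite size_words in nr; suff r0 : r = 0%N by rewrite r0 add0n in nr.
apply/eqP; rewrite -leqn0 leqNgt; apply/negP => rpos.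
pose c : 'rV[R]_r := delta_mx 0 (Ordinal rpos).
have Du : D (lincomb ((c *m K) 0) e).
  exact: (subspace_lincomb (dirichlet_subspace _ _ hq)).
have [||||_ _ h] := @cutoff_rayleigh _ q SG mu B hq hSG hmu xpredT k x _ (0 : plane -> R)
  x0 xk Du _ _ _ _ (Ee _).
- exact: within_continuous0.
- by [].
- by [].
- by move=> w wk _; exact: van.
have cK0 : c *m K = 0.
  apply/rowP => i; rewrite [RHS]mxE; apply: (fe _ (h _)).
  by rewrite /gasket_inner /Rintegral (eq_integral (cst 0%E)) ?integral0 // => y _; rewrite mul0r.
have : c = 0 by apply: (row_free_inj Kfree); rewrite cK0 mul0mx.
by move=> /rowP/(_ (Ordinal rpos)); rewrite !mxE !eqxx => /eqP; rewrite oner_eq0.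
Qed.

Lemma exists_pow5_gt (y : R) : exists k : nat, y < 5 ^+ k.
Proof.
have [n hn] := @geometric_lt R `|y| 1 ltr01.
exists n; have p2 : 0 < (2 : R) ^+ n by rewrite exprn_gt0.
apply: lt_le_trans (_ : 2 ^+ n <= _); last by apply: lerXn2r; rewrite ?nnegrE //; lra.
move: hn; rewrite exprVn mulrC ltr_pdivrMr // mul1r; apply: le_lt_trans; exact: ler_norm.
Qed.

Lemma counting_functionP x : 0 <= x -> exists n, [/\ counting_function q SG mu B x = n%:R%:E,
  admissible D EE II x n & forall k, admissible D EE II x k -> (k <= n)%N].
Proof.
move=> x0; have [k xk] := exists_pow5_gt (16 * x).
rewrite counting_functionE.
apply: (eigencountP (dirichlet_subspace SG B hq) (energy_psd SG B hq) (inner_psd mu B hq hSG) _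
  (fun n => admissible_bounded x0 xk)) => u l Du Eu Iu.
exact: (dirichlet_compact hq hSG hmu Bq0 Du Eu Iu).
Qed.

End Counting.

(** * Cutting off along the bottom line *)

Section Cutoff.
Context {R : realType}.
Local Notation plane := (R * R)%type.
Variables (q : 'I_3 -> plane) (SG : set plane) (mu : probability plane R).
Hypotheses (hq : equilateral q) (hSG : is_gasket q SG) (hmu : is_gasket_measure q SG mu).

Local Notation D0 := (dirichlet_domain q SG (vertices0 q) : set (plane -> R)).
Local Notation DO := (dirichlet_domain q SG (Omega_boundary q) : set (plane -> R)).
Local Notation EE := (energy_form q).
Local Notation II := (gasket_inner SG mu).

Lemma vertices_sub_boundary : vertices0 q `<=` Omega_boundary q.
Proof.
move=> _ [i _ <-]; elim/I3P: i; first by left.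
  by right; exists 0; rewrite /= ?in_itv /= ?lexx ?ler01 // subr0 scale1r scale0r addr0.
by right; exists 1; rewrite /= ?in_itv /= ?lexx ?ler01 // subrr scale1r scale0r add0r.
Qed.

Lemma dirichlet_Omega_sub : DO `<=` D0.
Proof. by move=> u [fu uB]; split=> // x /vertices_sub_boundary/uB. Qed.

Lemma admissible_Omega_sub x n : admissible DO EE II x n -> admissible D0 EE II x n.
Proof. by move=> [e [De fe Ee]]; exists e; split=> // i; apply: dirichlet_Omega_sub. Qed.

(** Cells of level [k] whose word contains 0 lie at height at least 2^-k, the others at height at
    most 2^-k with equality only at F_w q_0. There the two prescriptions agree once [f] vanishes. *)
Definition cutoff k (f : plane -> R) : plane -> R :=
  fun x => if 2^-1 ^+ k <= bary q 0 x then f x else 0.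

Lemma bary_bottom_word w y : 0 \notin w ->
  bary q 0 (ifs_word q w y) = 2^-1 ^+ size w * bary q 0 y.
Proof.
elim: w => [|i w IH] /=; first by rewrite expr0 mul1r.
rewrite inE negb_or => /andP[i0 w0]; rewrite (bary_ifs hq) (negPf i0) addr0 IH // mulrA -exprS.
by [].
Qed.

Lemma bary_upper_word w y : 0 \in w -> triangle q y ->
  2^-1 ^+ size w <= bary q 0 (ifs_word q w y).
Proof.
move=> + ty; elim: w => [//|i w IH]; rewrite inE /= (bary_ifs hq) exprS => h.
apply: ler_wpM2l; first by rewrite invr_ge0.
have tw := triangle_ifs_word hq w ty 0.
case: (eqVneq 0 i) h => [_ _|_ /= /IH h]; last by rewrite addr0.
have : 2^-1 ^+ size w <= 1 :> R by rewrite exprn_ile1 //; lra.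
by move=> h1; apply: le_trans h1 _; rewrite lerDr.
Qed.

Lemma cutoff_upper k f w y : w \in words k -> 0 \in w -> SG y ->
  cutoff k f (ifs_word q w y) = f (ifs_word q w y).
Proof.
rewrite mem_words => /eqP <- w0 Sy.
by rewrite /cutoff bary_upper_word //; exact: (gasket_triangle hq hSG).
Qed.

Lemma cutoff_bottom k f w y : w \in words k -> 0 \notin w -> SG y ->
  f (ifs_word q w (q 0)) = 0 -> cutoff k f (ifs_word q w y) = 0.
Proof.
rewrite mem_words => /eqP <- w0 Sy fw; rewrite /cutoff bary_bottom_word //.
have p2 : 0 < 2^-1 ^+ size w :> R by rewrite exprn_gt0 // invr_gt0.
case: ifP => //; rewrite -{1}[2^-1 ^+ _]mulr1 ler_pM2l // => h.
have ty := gasket_triangle hq hSG Sy.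
have by1 : bary q 0 y = 1 by apply/eqP; rewrite eq_le h (triangle_le1 hq).
by rewrite (triangle_bary_eq1 hq ty by1).
Qed.

(** Gluing along two finite, closed unions of cells: the function is [f] where the word contains 0,
    and 0 on the other cells. *)
Lemma cutoff_continuous k f : {within SG, continuous f} ->
  (forall w, w \in words k -> 0 \notin w -> f (ifs_word q w (q 0)) = 0) ->
  {within SG, continuous (cutoff k f)}.
Proof.
move=> cf f0.
pose cells (P : pred (seq 'I_3)) :=
  \big[setU/set0]_(w <- [seq w <- words k | P w]) (ifs_word q w @` SG).
have cellsP P x : cells P x -> exists w y, [/\ w \in words k, P w, SG y & x = ifs_word q w y].
  rewrite /cells -bigcup_seq => -[w /=]; rewrite mem_filter => /andP[Pw wk] [y Sy <-].
  by exists w, y.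
have closedP P : closed (cells P).
  apply: closed_bigsetU => w _; apply: compact_closed => //.
  apply: continuous_compact; last by case: hSG.
  by apply: continuous_subspaceT; exact: ifs_word_continuous.
have cellsS P : cells P `<=` SG.
  by move=> x /cellsP[w [y [_ _ Sy ->]]]; exact: gasket_ifs_word.
have SGE : SG = cells (fun w => 0 \in w) `|` cells (fun w => 0 \notin w).
  apply/seteqP; split=> [x Sx|x [/cellsS//|/cellsS//]].
  have [w [y [wk Sy xy]]] := gasket_words hSG k Sx.
  have [w0|w0] := boolP (0 \in w); [left|right]; rewrite /cells -bigcup_seq;
    exists w => /=; rewrite ?mem_filter ?wk ?w0 //; by exists y.
rewrite SGE; apply: withinU_continuous => //.
  apply: (@subspace_eq_continuous _ _ _ f).
    by move=> x; rewrite inE => /cellsP[w [y [wk w0 Sy ->]]]; exact/esym/cutoff_upper.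
  exact: continuous_subspaceW (cellsS _) cf.
apply: (@subspace_eq_continuous _ _ _ (fun=> 0)); last by move=> x; exact: cvg_cst.
move=> x; rewrite inE => /cellsP[w [y [wk w0 Sy ->]]].
by apply/esym/cutoff_bottom => //; exact: f0.
Qed.

Lemma cutoff_boundary k f : D0 f -> forall x, Omega_boundary q x -> cutoff k f x = 0.
Proof.
move=> [_ f0] x [->|[t _ <-]].
  by rewrite /cutoff (f0 (q 0)) ?if_same //; exists 0.
rewrite /cutoff ifF //; apply/negP => /=.
have -> : bary q 0 ((1 - t) *: q 1 + t *: q 2) = 0.
  have := cross_neq0 hq; rewrite /bary /cross !I3_eqs.
  case: (q 0) (q 1) (q 2) => [x0 y0] [x1 y1] [x2 y2] /= d0.
  by rewrite -![_ *: _]/(_ * _); field.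
by rewrite leNgt exprn_gt0 // invr_gt0.
Qed.

Lemma admissible_cutoff x k n : 0 <= x -> 16 * x < 5 ^+ k ->
  admissible D0 EE II x n ->
  exists r, (n <= r + 2 ^ k)%N /\ admissible DO EE II x r.
Proof.
move=> x0 xk [e [De fe Ee]].
have Bq0 : vertices0 q (q 0) by exists 0.
have [r [K [nr Kfree van]]] := vanishing_subspace q e [seq w <- words k | 0 \notin w].
rewrite size_filter count_bottom_words in nr.
pose L (c : 'rV[R]_r) := lincomb ((c *m K) 0) e.
have DL c : D0 (L c) by exact: (subspace_lincomb (dirichlet_subspace _ _ hq)).
have vanL c w : w \in words k -> 0 \notin w -> L c (ifs_word q w (q 0)) = 0.
  by move=> wk w0; apply: van; rewrite mem_filter w0.
have hL c : [/\ bounded_energy q (cutoff k (L c)),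
     EE (cutoff k (L c)) (cutoff k (L c)) <= x * II (cutoff k (L c)) (cutoff k (L c)) &
     II (cutoff k (L c)) (cutoff k (L c)) = 0 -> II (L c) (L c) = 0].
  apply: (@cutoff_rayleigh _ q SG mu (vertices0 q) hq hSG hmu (fun w => 0 \notin w) k x) => //.
  - apply: cutoff_continuous => [|w]; [exact: (dirichlet_continuous hq (DL c)) | exact: vanL].
  - by move=> w y wk; rewrite negbK; exact: cutoff_upper.
  - by move=> w y wk w0 Sy; apply: cutoff_bottom => //; exact: vanL.
  - exact: vanL.
  - exact: Ee.
exists r; split=> //.
exists (fun a => cutoff k (L (delta_mx 0 a))).
(* The cutoff is linear, so combinations of cut-off basis functions are cut-off combinations. *)
have LE (c : 'I_r -> R) : lincomb c (fun a => cutoff k (L (delta_mx 0 a))) =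
    cutoff k (L (\row_a c a)).
  apply/funext => y; rewrite lincombE /cutoff; case: ifP => _; last first.
    by rewrite big1 // => a _; rewrite mulr0.
  rewrite /L lincombE; under eq_bigr do rewrite lincombE mulr_sumr.
  rewrite exchange_big /=; apply: eq_bigr => i _.
  rewrite [in RHS]mxE mulr_suml; apply: eq_bigr => a _.
  by rewrite -rowE !mxE mulrA.
split=> [a|c|c].
- apply/(dirichletP SG (Omega_boundary q) hq); split.
  + apply: cutoff_continuous => [|w]; [exact: (dirichlet_continuous hq (DL _)) | exact: vanL].
  + by have [] := hL (delta_mx 0 a).
  + by apply: cutoff_boundary; exact: DL.
(* A null cutoff comes from a null function; freeness of [e] and of the rows of [K] then gives zero
   coefficients. *)
- rewrite LE => I0; have [_ _ h] := hL (\row_a c a).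
  have cK0 : \row_a c a *m K = 0.
    by apply/rowP => i; rewrite [RHS]mxE; exact: (fe _ (h I0)).
  have c0 : \row_a c a = 0 by apply: (row_free_inj Kfree); rewrite cK0 mul0mx.
  by move=> a; have /rowP/(_ a) := c0; rewrite !mxE.
- by rewrite LE; have [] := hL (\row_a c a).
Qed.

End Cutoff.

(** With k - 1 the integer part of log_5(16x), one has 5^(k-1) <= 16x < 5^k, and 2^(k-1) <=
    2^(log_5(16x)) = (16x)^(ln 2/ln 5). *)
Lemma pow2_le_powR {R : realType} (x : R) : 1 <= x ->
  exists k : nat, 16 * x < 5 ^+ k /\
    2 ^+ k <= 2 * (16 `^ (ln 2 / ln 5)) * x `^ (ln 2 / ln 5) :> R.
Proof.
move=> x1; have x0 : 0 < x by lra.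
have l5 : 0 < ln (5 : R) by apply: ln_gt0; lra.
have l2 : 0 < ln (2 : R) by apply: ln_gt0; lra.
have y0 : 0 < 16 * x by lra.
have ly : 0 <= ln (16 * x) by apply: ln_ge0; lra.
pose t := ln (16 * x) / ln 5; have t0 : 0 <= t by rewrite divr_ge0 // ltW.
pose n := Num.truncn t; have /andP[n1 n2] := truncn_itv t0.
have powE (b : R) m : 0 < b -> b ^+ m = expR (m%:R * ln b).
  by move=> b0; rewrite mulrC expRM_natr lnK.
exists n.+1; split.
  rewrite powE // -ltr_ln ?posrE ?expR_gt0 // expRK -ltr_pdivrMr //.
rewrite exprS -mulrA; apply: ler_wpM2l => //.
rewrite -powRM; [|lra|lra]; rewrite powE // /powR gt_eqF // ler_expR.
have -> : ln 2 / ln 5 * ln (16 * x) = t * ln 2 by rewrite /t; ring.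
by apply: ler_wpM2r; [exact: ltW | exact: n1].
Qed.

Theorem theorem3p10 (R : realType) (q : 'I_3 -> R * R) (SG : set (R * R))
    (mu : probability (R * R)%type R)
    (hq : equilateral q) (hSG : is_gasket q SG)
    (hmu : is_gasket_measure q SG mu) :
  let rho0 := counting_function q SG mu (vertices0 q) in
  let rhoOmega := counting_function q SG mu (Omega_boundary q) in
  exists2 C : R, 0 < C &
    \forall x \near +oo,
      (0 <= rho0 x - rhoOmega x)%E /\
      (rho0 x - rhoOmega x <= (C * (x `^ (ln 2 / ln 5) * ln x))%:E)%E.
Proof.
(* The constant is the one in the bound on 2^k. *)
move=> rho0 rhoOmega; exists (2 * 16 `^ (ln 2 / ln 5)).
  by rewrite mulr_gt0 // powR_gt0.
(* Beyond e the factor ln x is at least 1, so the bound 2^k <= C x^(ln 2/ln 5) suffices. *)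
exists (expR 1); split; first exact: num_real.
move=> x xe.
have x1 : 1 <= x by apply: le_trans (ltW xe); rewrite -expR0 ler_expR.
have x0 : 0 <= x by lra.
have lx : 1 <= ln x by rewrite -[leLHS]expRK ler_ln ?posrE ?expR_gt0 ?(ltW xe) //; lra.
have [k [xk k2]] := pow2_le_powR x1.
have B0 : vertices0 q (q 0) by exists 0.
have BO : Omega_boundary q (q 0) by left.
have [n0 [e0 a0 m0]] := counting_functionP hq hSG hmu B0 x0.
have [nO [eO aO mO]] := counting_functionP hq hSG hmu BO x0.
have nO0 : (nO <= n0)%N by apply: m0; exact: admissible_Omega_sub.
have [r [nr ar]] := admissible_cutoff hq hSG hmu x0 xk a0.
have n0O : (n0 <= nO + 2 ^ k)%N by apply: leq_trans nr _; rewrite leq_add2r; exact: mO.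
rewrite /rho0 /rhoOmega e0 eO -EFinB !lee_fin subr_ge0 ler_nat nO0; split=> //.
apply: le_trans (_ : 2 ^+ k <= _).
  by rewrite lerBlDl -natrX -natrD ler_nat.
apply: le_trans k2 _; rewrite [leRHS]mulrA ler_peMr //.
by rewrite mulr_ge0 ?mulr_ge0 ?powR_ge0.
Qed.
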